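(* Let $n,d,m,N,K$ be positive integers. Let $x_1,\dots,x_n\in\mathbb{R}^d$ with $\|x_i\|_2=1$ for all $i$, and labels $y_1,\dots,y_n\in\mathbb{R}$ with $|y_i|=O(1)$; write $y=(y_1,\dots,y_n)\in\mathbb{R}^n$. Let $S_1,\dots,S_N$ be a partition of $[n]$ into pairwise disjoint sets. Initialize $u_r(0)\sim\mathcal{N}(0,I_d)$ i.i.d. for $r\in[m]$ and $a_r$ i.i.d. uniform on $\{-1,+1\}$ (independent of the $u_r(0)$), and run the federated learning algorithm described in the context. Let $H(0)\in\mathbb{R}^{n\times n}$ be given by $H(0)_{i,j}=\frac1m\sum_{r=1}^m x_i^\top x_j\mathbf{1}_{u_r(0)^\top x_i\ge 0,\,u_r(0)^\top x_j\ge 0}$, let $\lambda=\lambda_{\min}(H(0))$ and assume $\lambda\in(0,1]$, and let $\kappa$ be the condition number of $H(0)$. Suppose $m=\Omega(\lambda^{-4}n^4\log(n/\delta))$, $\eta_{\mathrm{local}}=O(\lambda/(\kappa K n^2))$ and $\eta_{\mathrm{global}}=O(1)$. Then with probability at least $1-\delta$ over the random initialization, for all $t=0,1,2,\dots$, \[ \|y(t)-y\|_2^2\le\Big(1-\frac{\eta_{\mathrm{global}}\eta_{\mathrm{local}}\lambda K}{2N}\Big)^t\|y(0)-y\|_2^2 . \]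
   Context: $\phi(z)=\max\{z,0\}$ is the ReLU. For $u=(u_1,\dots,u_m)\in\mathbb{R}^{d\times m}$ (columns $u_r\in\mathbb{R}^d$), the network is $f(u,x)=\frac{1}{\sqrt m}\sum_{r=1}^m a_r\phi(u_r^\top x)$; only the first layer $u$ is trained, $a$ stays fixed. Federated learning algorithm (FedAvg with $N$ clients, client $c$ holding data $\{(x_i,y_i):i\in S_c\}$): at each global round $t=0,1,2,\dots$, every client $c\in[N]$ sets $w_{0,c}(t)=u(t)$ and performs $K$ local gradient descent steps with step size $\eta_{\mathrm{local}}$ on the local loss $L_c(w)=\frac12\sum_{i\in S_c}(f(w,x_i)-y_i)^2$, i.e. for each $r\in[m]$, $w_{k,c,r}(t)=w_{k-1,c,r}(t)-\eta_{\mathrm{local}}\frac{1}{\sqrt m}\sum_{i\in S_c}(f(w_{k-1,c}(t),x_i)-y_i)a_r x_i\mathbf{1}_{w_{k-1,c,r}(t)^\top x_i\ge0}$, $k=1,\dots,K$. The server then sets $u(t+1)=u(t)+\eta_{\mathrm{global}}\cdot\frac1N\sum_{c\in[N]}(w_{K,c}(t)-u(t))$. The prediction vector is $y(t)\in\mathbb{R}^n$ with $y(t)_i=f(u(t),x_i)$. $O(\cdot),\Omega(\cdot)$ hide absolute constants (sufficiently large constant in $\Omega$, sufficiently small in the step-size bounds). *)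

(* Defs.v *)
From HB Require Import structures.
From mathcomp Require Import all_boot all_order all_algebra.
From mathcomp Require Import all_classical all_reals all_analysis.
Set Implicit Arguments. Unset Strict Implicit. Unset Printing Implicit Defensive.
Import Order.TTheory GRing.Theory Num.Theory.
Local Open Scope ring_scope.
Local Open Scope classical_set_scope.

Section FedNet.
Variable R : realType.

Definition dotv (d : nat) (v w : 'I_d -> R) : R := \sum_(k < d) v k * w k.

Definition relu (z : R) : R := Num.max z 0.

Definition net (d m : nat) (a : 'I_m -> R) (u : 'I_m -> 'I_d -> R)
  (x : 'I_d -> R) : R :=
  (Num.sqrt m%:R)^-1 * \sum_(r < m) a r * relu (dotv (u r) x).

(* one local gradient step of client with data index set Sc *)
Definition local_step (n d m : nat) (a : 'I_m -> R) (x : 'I_n -> 'I_d -> R)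
  (y : 'I_n -> R) (Sc : {set 'I_n}) (eta : R) (w : 'I_m -> 'I_d -> R) :
  'I_m -> 'I_d -> R :=
  fun r k => w r k - eta * (Num.sqrt m%:R)^-1 *
    \sum_(i in Sc) (net a w (x i) - y i) * a r * x i k *
                   (if 0 <= dotv (w r) (x i) then 1 else 0).

Definition fed_round {n d m N : nat} (K : nat) (a : 'I_m -> R) (x : 'I_n -> 'I_d -> R)
  (y : 'I_n -> R) (S : 'I_N -> {set 'I_n}) (eta_local eta_global : R)
  (u : 'I_m -> 'I_d -> R) : 'I_m -> 'I_d -> R :=
  fun r k => u r k + eta_global * (N%:R^-1 *
    \sum_(c < N) (iter K (local_step a x y (S c) eta_local) u r k - u r k)).

Definition fed_iter {n d m N : nat} (K : nat) (a : 'I_m -> R) (x : 'I_n -> 'I_d -> R)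
  (y : 'I_n -> R) (S : 'I_N -> {set 'I_n}) (eta_local eta_global : R)
  (u0 : 'I_m -> 'I_d -> R) (t : nat) : 'I_m -> 'I_d -> R :=
  iter t (fed_round K a x y S eta_local eta_global) u0.

Definition sq_err (n d m : nat) (a : 'I_m -> R) (x : 'I_n -> 'I_d -> R)
  (y : 'I_n -> R) (u : 'I_m -> 'I_d -> R) : R :=
  \sum_(i < n) (net a u (x i) - y i) ^+ 2.

Definition gram0 (n d m : nat) (x : 'I_n -> 'I_d -> R) (u : 'I_m -> 'I_d -> R)
  : 'M[R]_n :=
  \matrix_(i, j) (m%:R^-1 * \sum_(r < m) dotv (x i) (x j) *
     (if (0 <= dotv (u r) (x i)) && (0 <= dotv (u r) (x j)) then 1 else 0)).

Definition lambda_min (n : nat) (H : 'M[R]_n) : R := inf [set a : R | eigenvalue H a].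
Definition lambda_max (n : nat) (H : 'M[R]_n) : R := sup [set a : R | eigenvalue H a].
Definition cond_number (n : nat) (H : 'M[R]_n) : R := lambda_max H / lambda_min H.

End FedNet.

Definition mutually_independent d (T : measurableType d) (R : realType)
  (P : probability T R) (I : finType) (X : I -> T -> R) : Prop :=
  forall B : I -> set R, (forall i, measurable (B i)) ->
    P (\bigcap_(i in [set: I]) (X i @^-1` B i)) =
    (\prod_(i : I) P (X i @^-1` B i))%E.

Definition init_family d (T : measurableType d) (R : realType)
  (P : probability T R) (m dim : nat) (U : 'I_m -> 'I_dim -> {RV P >-> R})
  (A : 'I_m -> {RV P >-> R}) : ('I_m * 'I_dim + 'I_m)%type -> T -> R :=
  fun i => match i with inl rk => (U rk.1 rk.2 : T -> R) | inr r => (A r : T -> R) end.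

(* Main.v *)
Require Import Defs.
From HB Require Import structures.
From mathcomp Require Import all_boot all_order all_algebra.
From mathcomp Require Import all_classical all_reals all_analysis.
From mathcomp Require Import measurable_realfun ring lra.
Import Order.TTheory GRing.Theory Num.Theory.
Import numFieldNormedType.Exports.
Set Implicit Arguments.
Unset Strict Implicit.
Unset Printing Implicit Defensive.
Local Open Scope ring_scope.
Local Open Scope classical_set_scope.

(** Write [e] for the residual of the network and [theta] for [eta_global * eta_local * K / N].
    One round changes [e] into [e - theta (H(0) e + p)].  The error [p] has two sources: the
    residuals drift during the local steps, by a relative amount of order [eta_local K n], and
    some neurons change their activation on some data point.  As long as the residual decays
    geometrically, every preactivation [u_r . x_j] stays within
    [D ~ sqrt n |e(0)| / (lambda sqrt m)] of its initial value, so only neurons with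
    [|u_r(0) . x_j| <= D] can flip.  Only inner products with the data enter, never the norm of
    a weight vector.

    With high probability few neurons are that close to a boundary (the preactivations are
    standard Gaussian), and the initial outputs are subgaussian: averaging over the signs turns
    the moment generating function of a neuron into a [cosh], so that the ReLU is dominated by the
    full Gaussian.  The eigenvalue [lambda] is random, but the assumption on [m] says exactly
    that [lambda] exceeds a deterministic threshold, on which the events are calibrated.

    For [n = 1] and [delta] close to 1 the quantity [log (n / delta)] is not bounded below, so the
    assumption on [m] is void.  Then only a small probability of success is required: for
    bounded [m] the event that every neuron is inactive suffices ([lambda = 0]), and for large [m]
    a positive proportion of the neurons is active with positive probability. *)

(** * Least eigenvalue of a symmetric matrix *)

Lemma continuous_mul_fun (R : realType) (n : nat) (f g : 'rV[R]_n -> R) :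
  continuous f -> continuous g -> continuous (fun v => f v * g v).
Proof. by move=> cf cg x; exact: (cvgM (cf x) (cg x)). Qed.

Lemma continuous_sum_fun (R : realType) (n : nat) (I : finType)
    (F : I -> 'rV[R]_n -> R) :
  (forall i, continuous (F i)) -> continuous (fun v => \sum_i F i v).
Proof.
move=> Fc; apply: (@continuous_big R I +%R 0 xpredT _ 'rV[R]_n (index_enum I) F).
  by move=> ab; apply: cvgD; [exact: cvg_fst|exact: cvg_snd].
by move=> i _; exact: Fc.
Qed.

Lemma mulmx_tr_ge0 (R : realType) (n : nat) (z : 'rV[R]_n) : 0 <= (z *m z^T) 0 0.
Proof. by rewrite mxE sumr_ge0// => j _; rewrite mxE -expr2 sqr_ge0. Qed.

Lemma mulmx_tr_eq0 (R : realType) (n : nat) (z : 'rV[R]_n) :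
  (z *m z^T) 0 0 = 0 -> z = 0.
Proof.
rewrite mxE => /psumr_eq0P h; apply/rowP => j.
rewrite [RHS]mxE; apply/eqP; rewrite -sqrf_eq0 expr2; apply/eqP.
have := h _ j isT; rewrite mxE; apply => k _.
by rewrite mxE -expr2 sqr_ge0.
Qed.

(** Compactness of the unit sphere gives a minimizer of the quadratic form there, and homogeneity
    carries the bound to every [v]. *)
Lemma quad_form_min (R : realType) (n : nat) (H : 'M[R]_n) : (0 < n)%N ->
  exists2 c : 'rV[R]_n, c *m c^T = 1%:M & forall v : 'rV[R]_n,
    (c *m H *m c^T) 0 0 * (v *m v^T) 0 0 <= (v *m H *m v^T) 0 0.
Proof.
move=> n0.
pose f := fun v : 'rV[R]_n => (v *m H *m v^T) 0 0.
pose g := fun v : 'rV[R]_n => (v *m v^T) 0 0.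
have cc (i : 'I_n) : continuous (fun v : 'rV[R]_n => v 0 i).
  by move=> x; exact: coord_continuous.
have fc : continuous f.
  have -> : f = fun v => \sum_j (\sum_i v 0 i * H i j) * v 0 j.
    apply/funext => v; rewrite /f mxE; apply: eq_bigr => j _.
    by rewrite !mxE.
  apply: (@continuous_sum_fun R n 'I_n
    (fun j v => (\sum_i v 0 i * H i j) * v 0 j)) => j.
  apply: continuous_mul_fun; last exact: cc.
  apply: (@continuous_sum_fun R n 'I_n (fun i v => v 0 i * H i j)) => i.
  by apply: continuous_mul_fun; [exact: cc|exact: cst_continuous].
have gE v : g v = \sum_j v 0 j ^+ 2.
  by rewrite /g mxE; apply: eq_bigr => j _; rewrite mxE expr2.
have gc : continuous g.
  have -> : g = fun v => \sum_j v 0 j * v 0 j.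
    apply/funext => v; rewrite /g mxE; apply: eq_bigr => j _.
    by rewrite !mxE.
  apply: (@continuous_sum_fun R n 'I_n (fun j v => v 0 j * v 0 j)) => j.
  by apply: continuous_mul_fun; exact: cc.
pose A := [set v | g v = 1].
have cA : compact A.
  apply: bounded_closed_compact; last first.
    have -> : A = g @^-1` [set 1] by [].
    by apply: closed_comp => [x _|]; [exact: gc|exact: closed_eq].
  exists 1; split; first exact: num_real.
  move=> M M1 v /= gv1; rewrite -[M]gtr0_norm; last by lra.
  rewrite [`|v|]mx_normrE; apply/bigmax_leP; split; first by rewrite normr_ge0.
  move=> -[i j] _ /=; rewrite (ord1 i) (gtr0_norm (x := M)); last by lra.
  apply: le_trans (ltW M1); rewrite -(@ler_pXn2r _ 2) ?nnegrE// expr1n.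
  rewrite -gv1 gE (bigD1 j)//= real_normK ?num_real// lerDl.
  by apply: sumr_ge0 => k _; exact: sqr_ge0.
have A0 : A !=set0.
  exists (delta_mx 0 (Ordinal n0)); rewrite /A /= gE (bigD1 (Ordinal n0))//=.
  rewrite mxE !eqxx/= expr1n big1 ?addr0// => j /negPf jn.
  by rewrite mxE jn andbF expr0n.
have [c] := compact_EVT_min A0 cA (continuous_subspaceT fc).
rewrite inE => cA1 cmin; exists c.
  by apply/matrixP => i j; rewrite !ord1 [LHS]cA1 mxE eqxx.
move=> v; change (f c * g v <= f v).
have [v0|gv0] := eqVneq (g v) 0.
  rewrite v0 mulr0; suff -> : v = 0 by rewrite /f !mul0mx mxE.
  exact: mulmx_tr_eq0.
have gvp : 0 < g v.
  by rewrite lt_neqAle eq_sym gv0 mulmx_tr_ge0.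
pose s := (Num.sqrt (g v))^-1.
have s2 : s * s = (g v)^-1 by rewrite -expr2 exprVn sqr_sqrtr// ltW.
have fs : f (s *: v) = (g v)^-1 * f v.
  by rewrite /f -!scalemxAl linearZ/= -scalemxAr !mxE mulrA s2.
have gs : g (s *: v) = 1.
  by rewrite /g -scalemxAl linearZ/= -scalemxAr 2!mxE mulrA s2 -/(g v) mulVf.
have := cmin (s *: v); rewrite inE => /(_ gs); rewrite fs => h.
by move: h; rewrite ler_pdivlMl// mulrC.
Qed.

(** A quadratic in [t] that vanishes at 0 and is never negative has zero slope there. The test point
    is [- (a / (b + 1))]; the shift by 1 covers [b = 0]. *)
Lemma lin_coef_eq0 (R : realFieldType) (a b : R) : 0 <= b -> 0 <= a ->
  (forall t, 0 <= 2 * t * a + t ^+ 2 * b) -> a = 0.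
Proof.
move=> b0 a0 /(_ (- (a / (b + 1)))).
have b1 : 0 < b + 1 by lra.
have -> : 2 * - (a / (b + 1)) * a + (- (a / (b + 1))) ^+ 2 * b =
  - (a ^+ 2 * (b + 2)) / (b + 1) ^+ 2 by field; lra.
rewrite mulNr oppr_ge0 pmulr_lle0 ?invr_gt0 ?exprn_gt0// pmulr_lle0; last by lra.
by rewrite le_eqVlt ltNge sqr_ge0 orbF sqrf_eq0 => /eqP.
Qed.

(** First variation: moving the minimizer [c] by [t] along [w = c *m H - mu *: c] changes the form
    minus [mu] times the squared norm by [2 t |w|^2 + t^2 b]. Minimality forces [w = 0], which is
    the equation of a (row) eigenvector. *)
Lemma quad_form_min_eigen (R : realType) (n : nat) (H : 'M[R]_n) (c : 'rV[R]_n) :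
  H^T = H -> c *m c^T = 1%:M ->
  (forall v : 'rV[R]_n,
    (c *m H *m c^T) 0 0 * (v *m v^T) 0 0 <= (v *m H *m v^T) 0 0) ->
  eigenvalue H ((c *m H *m c^T) 0 0).
Proof.
move=> Hs c1 cmin; set mu := (c *m H *m c^T) 0 0.
have muE : (c *m H *m c^T) 0 0 = mu by [].
clearbody mu.
apply/eigenvalueP; exists c; last first.
  apply/eqP => c0; move: c1; rewrite c0 mul0mx => /matrixP/(_ 0 0).
  by rewrite !mxE => /eqP; rewrite eq_sym oner_eq0.
pose w := c *m H - mu *: c.
pose b := (w *m H *m w^T) 0 0 - mu * (w *m w^T) 0 0.
pose a := (w *m w^T) 0 0.
have cw : (w *m c^T) 0 0 = (c *m w^T) 0 0.
  have <- : (w *m c^T)^T = c *m w^T by rewrite trmx_mul trmxK.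
  by rewrite [RHS]mxE.
have wHc : (w *m H *m c^T) 0 0 = (c *m H *m w^T) 0 0.
  have <- : (w *m H *m c^T)^T = c *m H *m w^T by rewrite !trmx_mul trmxK Hs mulmxA.
  by rewrite [RHS]mxE.
have aE : a = (c *m H *m w^T) 0 0 - mu * (c *m w^T) 0 0.
  by rewrite /a {1}/w mulmxBl -scalemxAl !mxE.
have eD (A B : 'M[R]_1) : (A + B) 0 0 = A 0 0 + B 0 0 by rewrite mxE.
have eZ k (A : 'M[R]_1) : (k *: A) 0 0 = k * A 0 0 by rewrite mxE.
have exp1 t (z : 'rV[R]_n) (G : 'M[R]_n) : ((c + t *: z) *m G *m (c + t *: z)^T) 0 0 =
    (c *m G *m c^T) 0 0 + t * ((c *m G *m z^T) 0 0 + (z *m G *m c^T) 0 0) +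
    t ^+ 2 * (z *m G *m z^T) 0 0.
  rewrite linearD/= linearZ/= !(mulmxDl, mulmxDr) -!(scalemxAl, scalemxAr).
  rewrite !(eD, eZ); ring.
have key t : 0 <= 2 * t * a + t ^+ 2 * b.
  have := cmin (c + t *: w).
  have := exp1 t w 1%:M; rewrite !mulmx1 => ->; rewrite exp1 wHc cw muE c1.
  have -> : (1%:M : 'M[R]_1) 0 0 = 1 by rewrite mxE eqxx.
  rewrite -/a aE /b -/a aE; nra.
have a0 : 0 <= a by exact: mulmx_tr_ge0.
have b0 : 0 <= b.
  by rewrite /b subr_ge0 -muE; exact: cmin.
have := lin_coef_eq0 b0 a0 key.
move=> /mulmx_tr_eq0 w0.
by apply/eqP; rewrite -subr_eq0 -/w w0.
Qed.

Lemma eigen_quad (R : realType) (n : nat) (H : 'M[R]_n) (a : R) : eigenvalue H a ->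
  exists2 v : 'rV[R]_n, 0 < (v *m v^T) 0 0 & (v *m H *m v^T) 0 0 = a * (v *m v^T) 0 0.
Proof.
move=> /eigenvalueP[v vH v0]; exists v; last by rewrite vH -scalemxAl mxE.
rewrite lt_neqAle mulmx_tr_ge0 andbT.
by apply: contra v0 => /eqP/esym/mulmx_tr_eq0 ->.
Qed.

(** [lambda_min] is an [inf], which is informative only for a nonempty set that is bounded below.
    The Rayleigh minimum is an eigenvalue and a lower bound of all eigenvalues, hence equal to this
    [inf]. *)
Lemma lambda_min_quad (R : realType) (n : nat) (H : 'M[R]_n) : (0 < n)%N -> H^T = H ->
  eigenvalue H (lambda_min H) /\ forall v : 'rV[R]_n,
    lambda_min H * (v *m v^T) 0 0 <= (v *m H *m v^T) 0 0.
Proof.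
move=> n0 Hs; have [c c1 cmin] := quad_form_min H n0.
have ec := quad_form_min_eigen Hs c1 cmin.
suff -> : lambda_min H = (c *m H *m c^T) 0 0 by [].
have lb : lbound [set a | eigenvalue H a] ((c *m H *m c^T) 0 0).
  move=> a /= /eigen_quad[v vp va]; rewrite -(ler_pM2r vp) -va; exact: cmin.
apply/eqP; rewrite eq_le; apply/andP; split.
  by apply: ge_inf => //; exists ((c *m H *m c^T) 0 0).
by apply: lb_le_inf => //; exists ((c *m H *m c^T) 0 0).
Qed.

Lemma cond_number_ge1 (R : realType) (n : nat) (H : 'M[R]_n) : (0 < n)%N -> H^T = H ->
  0 < lambda_min H -> 1 <= cond_number H.
Proof.
move=> n0 Hs l0; have [el _] := lambda_min_quad n0 Hs.
rewrite /cond_number ler_pdivlMr// mul1r; apply: ub_le_sup => //.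
(* The [sup] in [lambda_max] needs a bounded spectrum; the Rayleigh minimum of [- H] provides the
   upper bound. *)
have [c c1 cmin] := quad_form_min (- H) n0.
exists (- (c *m (- H) *m c^T) 0 0) => a /= /eigen_quad[v vp va].
rewrite -(ler_pM2r vp) -va mulNr lerNr.
by apply: (le_trans (cmin v)); rewrite mulmxN mulNmx mxE.
Qed.

(** * One round of federated gradient descent *)

Section Deterministic.
Variable R : realType.
Variables (n d m : nat) (x : 'I_n -> 'I_d -> R) (y : 'I_n -> R) (a : 'I_m -> R).
Hypotheses (m0 : (0 < m)%N) (x1 : forall i, dotv (x i) (x i) = 1)
  (a1 : forall r, `|a r| = 1).
Implicit Types (w u v : 'I_m -> 'I_d -> R).

Let sm : R := Num.sqrt m%:R.
Let sm0 : 0 < sm. Proof. by rewrite sqrtr_gt0 ltr0n. Qed.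
Let smV0 : 0 < sm^-1. Proof. by rewrite invr_gt0. Qed.
Let smm : sm * sm = m%:R. Proof. by rewrite -expr2 sqr_sqrtr// ler0n. Qed.

Lemma dotv_sumr (f : 'I_d -> R) (b : R) (v : 'I_d -> R) (g : 'I_n -> 'I_d -> R)
    (c : 'I_n -> R) (S : {set 'I_n}) :
  dotv (fun k => v k - b * \sum_(i in S) c i * g i k) f =
  dotv v f - b * \sum_(i in S) c i * dotv (g i) f.
Proof.
rewrite /dotv big_distrr/=.
under [X in _ = _ - X]eq_bigr do rewrite !big_distrr/=.
rewrite [X in _ = _ - X]exchange_big/= -sumrB; apply: eq_bigr => k _.
rewrite mulrBl big_distrr/= big_distrl/=; congr (_ - _).
by apply: eq_bigr => i _; ring.
Qed.

(** Cauchy-Schwarz for unit vectors, read off from the squared norms of [x i - x j] and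
    [x i + x j]. *)
Lemma dotv_le1 i j : `|dotv (x i) (x j)| <= 1.
Proof.
have p1 : 0 <= dotv (fun k => x i k - x j k) (fun k => x i k - x j k).
  by apply: sumr_ge0 => k _; rewrite -expr2 sqr_ge0.
have p2 : 0 <= dotv (fun k => x i k + x j k) (fun k => x i k + x j k).
  by apply: sumr_ge0 => k _; rewrite -expr2 sqr_ge0.
have e1 : dotv (fun k => x i k - x j k) (fun k => x i k - x j k) =
    dotv (x i) (x i) - 2 * dotv (x i) (x j) + dotv (x j) (x j).
  rewrite /dotv big_distrr/= -sumrB -big_split/=; apply: eq_bigr => k _; ring.
have e2 : dotv (fun k => x i k + x j k) (fun k => x i k + x j k) =
    dotv (x i) (x i) + 2 * dotv (x i) (x j) + dotv (x j) (x j).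
  rewrite /dotv big_distrr/= -!big_split/=; apply: eq_bigr => k _; ring.
rewrite ler_norml; move: p1 p2; rewrite e1 e2 !x1; lra.
Qed.

Definition act (w : 'I_m -> 'I_d -> R) (r : 'I_m) (i : 'I_n) : R :=
  if 0 <= dotv (w r) (x i) then 1 else 0.

Definition resid (w : 'I_m -> 'I_d -> R) (i : 'I_n) : R := net a w (x i) - y i.

Lemma act_norm w r i : `|act w r i| <= 1.
Proof. by rewrite /act; case: ifP => _; rewrite ?normr1 ?normr0. Qed.

(** The gradient lies in the span of the data, so a step acts on the preactivations only through
    inner products of data points. *)
Lemma local_step_dot (Sc : {set 'I_n}) (eta : R) w r i :
  dotv (local_step a x y Sc eta w r) (x i) = dotv (w r) (x i) -
  eta * sm^-1 * \sum_(j in Sc) resid w j * a r * act w r j * dotv (x j) (x i).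
Proof.
have -> : local_step a x y Sc eta w r = fun k => w r k - eta * sm^-1 *
    \sum_(j in Sc) (resid w j * a r * act w r j) * x j k.
  apply/funext => k; rewrite /local_step; congr (_ - _ * _).
  by apply: eq_bigr => j _; rewrite /resid /act; ring.
by rewrite dotv_sumr.
Qed.

Lemma relu_lip (s t : R) : `|relu s - relu t| <= `|s - t|.
Proof.
rewrite /relu; have [s0|s0] := leP s 0; have [t0|t0] := leP t 0 => //.
- by rewrite subrr normr0.
- rewrite sub0r normrN distrC gtr0_norm// gtr0_norm; lra.
- rewrite subr0 gtr0_norm// gtr0_norm; lra.
Qed.

Lemma sumr_cst_le (F : 'I_m -> R) (b : R) : (forall r, F r <= b) ->
  \sum_r F r <= m%:R * b.
Proof.
move=> Fb; apply: (le_trans (ler_sum _ (fun r _ => Fb r))).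
by rewrite sumr_const card_ord mulr_natl.
Qed.

(** The ReLU is 1-Lipschitz and the signs have modulus 1, so the [m] neurons contribute at most [b]
    each; the factor [1 / sqrt m] leaves [sqrt m * b]. *)
Lemma net_diff_le w u i (b : R) :
  (forall r, `|dotv (w r) (x i) - dotv (u r) (x i)| <= b) ->
  `|net a w (x i) - net a u (x i)| <= sm * b.
Proof.
move=> wu; rewrite /net -mulrBr -sumrB normrM gtr0_norm//.
rewrite mulrC ler_pdivrMr//.
have -> : sm * b * sm = m%:R * b by rewrite -smm; ring.
apply: (le_trans (ler_norm_sum _ _ _)); apply: sumr_cst_le => r.
rewrite -mulrBr normrM a1 mul1r; exact: le_trans (relu_lip _ _) (wu r).
Qed.

(** Joint induction on [k]: small residual drift keeps the client's residuals below [2 * A0] in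
    total, so one more step moves a preactivation by at most [2 * eta * A0 / sm], and the network
    output by [sm] times as much. *)
Lemma local_drift (K : nat) (Sc : {set 'I_n}) (eta : R) u :
  0 <= eta -> 2 * n%:R * K%:R * eta <= 1 ->
  let A0 := \sum_(j in Sc) `|resid u j| in
  forall k, (k <= K)%N ->
  let w := iter k (local_step a x y Sc eta) u in
  (forall r i, `|dotv (w r) (x i) - dotv (u r) (x i)| <= 2 * k%:R * eta * A0 / sm)
  /\ (forall i, `|resid w i - resid u i| <= 2 * k%:R * eta * A0).
Proof.
move=> eta0 etaK A0.
have A00 : 0 <= A0 by apply: sumr_ge0 => j _; exact: normr_ge0.
elim=> [_|k IH kK].
  split=> [r i|i] /=; first by rewrite subrr normr0 !(mulr0, mul0r).
  by rewrite subrr normr0 !(mulr0, mul0r).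
have [IH1 IH2] := IH (ltnW kK).
set w := iter k _ u in IH1 IH2.
have kK' : k%:R <= K%:R :> R by rewrite ler_nat ltnW.
(* The accumulated drift adds at most [n * (2 * K * eta * A0) <= A0]; this is where the bound on the
   step size enters. *)
have sumw : \sum_(j in Sc) `|resid w j| <= 2 * A0.
  apply: (@le_trans _ _ (\sum_(j in Sc) (`|resid u j| + 2 * k%:R * eta * A0))).
    apply: ler_sum => j _; rewrite -lerBlDl.
    exact: le_trans (lerB_dist _ _) (IH2 j).
  rewrite big_split/= -/A0 sumr_const -[X in _ + X]mulr_natl.
  have cS : (#|Sc|)%:R <= n%:R :> R by rewrite ler_nat -[leqRHS]card_ord max_card.
  have : #|Sc|%:R * (2 * k%:R * eta * A0) <= n%:R * (2 * K%:R * eta * A0).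
    apply: ler_pM => //; first by rewrite !mulr_ge0.
    by apply: ler_wpM2r => //; apply: ler_wpM2r => //; rewrite ler_wpM2l.
  have : n%:R * (2 * K%:R * eta * A0) <= A0.
    have -> : n%:R * (2 * K%:R * eta * A0) = (2 * n%:R * K%:R * eta) * A0 by ring.
    by rewrite ler_piMl.
  lra.
have dot_step r i : `|dotv (iter k.+1 (local_step a x y Sc eta) u r) (x i) -
    dotv (u r) (x i)| <= 2 * k.+1%:R * eta * A0 / sm.
  rewrite iterS -/w local_step_dot.
  set s := \sum_(j in Sc) _.
  have s2 : `|s| <= 2 * A0.
    apply: (le_trans (ler_norm_sum _ _ _)); apply: le_trans sumw.
    apply: ler_sum => j _; rewrite !normrM a1 mulr1 -mulrA ler_piMr//.
    by apply: mulr_ile1; rewrite ?normr_ge0 ?act_norm ?dotv_le1.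
  have -> : dotv (w r) (x i) - eta / sm * s - dotv (u r) (x i) =
    (dotv (w r) (x i) - dotv (u r) (x i)) - eta / sm * s by ring.
  apply: (le_trans (ler_normB _ _)).
  have -> : 2 * k.+1%:R * eta * A0 / sm =
    2 * k%:R * eta * A0 / sm + eta / sm * (2 * A0) by rewrite -natr1; ring.
  apply: lerD; first exact: IH1.
  rewrite normrM ger0_norm ?mulr_ge0 ?(ltW smV0)//.
  by apply: ler_wpM2l => //; rewrite mulr_ge0 ?(ltW smV0).
split=> // i.
rewrite /resid.
set w' := iter k.+1 _ u.
have -> : net a w' (x i) - y i - (net a u (x i) - y i) =
  net a w' (x i) - net a u (x i) by ring.
have -> : 2 * k.+1%:R * eta * A0 = sm * (2 * k.+1%:R * eta * A0 / sm).
  by rewrite [RHS]mulrC divfK// gt_eqF.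
by apply: net_diff_le => r; exact: dot_step.
Qed.

Lemma local_sum_dot (Sc : {set 'I_n}) (eta : R) u r i K :
  dotv (iter K (local_step a x y Sc eta) u r) (x i) - dotv (u r) (x i) =
  - (eta / sm * \sum_(k < K) \sum_(j in Sc)
     resid (iter k (local_step a x y Sc eta) u) j * a r *
     act (iter k (local_step a x y Sc eta) u) r j * dotv (x j) (x i)).
Proof.
elim: K => [|K IH]; first by rewrite big_ord0 mulr0 subrr oppr0.
rewrite iterS local_step_dot big_ord_recr/= mulrDr opprD -IH; ring.
Qed.

(** * Averaging over the clients *)

Variables (N K : nat) (S : 'I_N -> {set 'I_n}) (el eg : R).
Hypotheses (N0 : (0 < N)%N)
  (Sdisj : forall (c c' : 'I_N) (i : 'I_n), i \in S c -> i \in S c' -> c = c')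
  (Scov : forall i : 'I_n, exists c : 'I_N, i \in S c).
Hypotheses (el0 : 0 <= el) (eg0 : 0 <= eg) (elK : 2 * n%:R * K%:R * el <= 1).

Let theta : R := eg * el * K%:R / N%:R.
Let theta0 : 0 <= theta.
Proof. by rewrite /theta !mulr_ge0 ?invr_ge0. Qed.

Let l1 u : R := \sum_j `|resid u j|.
Let A0 u c : R := \sum_(j in S c) `|resid u j|.

Lemma sum_partition (F : 'I_n -> R) : \sum_c \sum_(j in S c) F j = \sum_j F j.
Proof.
under eq_bigr do rewrite big_mkcond/=.
rewrite exchange_big/=; apply: eq_bigr => j _; have [c jc] := Scov j.
rewrite (bigD1 c)//= jc big1 ?addr0// => c' cc'; case: ifP => // jc'.
by rewrite (Sdisj jc jc') eqxx in cc'.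
Qed.

(** The server update is affine in the client weights, so preactivations are averaged in the same
    way. *)
Lemma fed_round_dot u r i :
  dotv (fed_round K a x y S el eg u r) (x i) - dotv (u r) (x i) =
  eg * (N%:R^-1 * \sum_(c < N)
    (dotv (iter K (local_step a x y (S c) el) u r) (x i) - dotv (u r) (x i))).
Proof.
rewrite /dotv; under [X in _ = _ * (_ * X)]eq_bigr do rewrite -sumrB.
rewrite [X in _ = _ * (_ * X)]exchange_big/= big_distrr/= big_distrr/= -sumrB.
apply: eq_bigr => k _; rewrite /fed_round mulrDl addrAC subrr add0r.
rewrite -!mulrA big_distrl/=; congr (_ * (_ * _)).
by apply: eq_bigr => c _; rewrite mulrBl.
Qed.

Lemma fed_round_move u r i :
  `|dotv (fed_round K a x y S el eg u r) (x i) - dotv (u r) (x i)| <=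
  2 * theta * l1 u / sm.
Proof.
rewrite fed_round_dot !normrM ger0_norm// [`|N%:R^-1|]ger0_norm ?invr_ge0//.
have -> : 2 * theta * l1 u / sm =
    eg * (N%:R^-1 * \sum_c (2 * K%:R * el * A0 u c / sm)).
  rewrite -mulr_suml -mulr_sumr /A0 sum_partition /theta /l1; ring.
apply: ler_wpM2l => //; apply: ler_wpM2l; first by rewrite invr_ge0.
apply: (le_trans (ler_norm_sum _ _ _)); apply: ler_sum => c _.
by have [h _] := local_drift (S c) u el0 elK (leqnn K); exact: h.
Qed.

(** * Neurons near an activation boundary, and the linearized round *)

Variables (u0 : 'I_m -> 'I_d -> R) (D nu : R).
(** Marks the neurons that could change activation on [x j] while staying within [D] of their
    initial preactivation. It depends on the initialization alone, so its sum can be bounded once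
    for all rounds. *)
Definition flip (r : 'I_m) (j : 'I_n) : R :=
  if `|dotv (u0 r) (x j)| <= D then 1 else 0.

Lemma flip_ge0 r j : 0 <= flip r j.
Proof. by rewrite /flip; case: ifP. Qed.

Lemma act_flip w r j : `|dotv (w r) (x j) - dotv (u0 r) (x j)| <= D ->
  `|act w r j - act u0 r j| <= flip r j.
Proof.
rewrite /flip => h; case: ifPn => [_|]; rewrite /act.
  by do 2 case: ifP => _; rewrite ?subrr ?subr0 ?sub0r ?normrN ?normr1 ?normr0 ?lexx ?ler01.
rewrite -ltNge lter_normr => hD.
have : (0 <= dotv (w r) (x j)) = (0 <= dotv (u0 r) (x j)).
  move: h; rewrite ler_norml => /andP[h1 h2].
  apply/idP/idP; case/orP: hD; lra.
by move=> ->; case: ifP => _; rewrite subrr normr0.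
Qed.

(** Off the marked neurons both preactivations lie on the initial side of the boundary, where the
    ReLU is linear and the error vanishes. On marked neurons the two terms cost [|v - w|] each. *)
Lemma relu_flip w v r j : `|dotv (w r) (x j) - dotv (u0 r) (x j)| <= D ->
  `|dotv (v r) (x j) - dotv (u0 r) (x j)| <= D ->
  `|relu (dotv (v r) (x j)) - relu (dotv (w r) (x j)) -
    act u0 r j * (dotv (v r) (x j) - dotv (w r) (x j))| <=
  flip r j * (2 * `|dotv (v r) (x j) - dotv (w r) (x j)|).
Proof.
move=> hw hv; rewrite /flip; case: ifPn => [_|].
  rewrite mul1r; apply: (le_trans (ler_normB _ _)).
  rewrite mulr_natl mulr2n; apply: lerD; first exact: relu_lip.
  by rewrite normrM ler_piMl// act_norm.
rewrite -ltNge mul0r normr_le0 /act /relu.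
move: hw hv; rewrite !ler_norml => /andP[h1 h2] /andP[h3 h4].
case: ifPn => [p|]; [rewrite ger0_norm// => hD|rewrite -ltNge => p; rewrite ltr0_norm// => hD].
  rewrite !max_l; [|lra|lra].
  by rewrite mul1r subrr.
rewrite !max_r; [|lra|lra].
by rewrite mul0r subrr subr0.
Qed.

(** The ideal displacement freezes the residuals at [u] and the activations at [u0] during all [K]
    steps. The first error term is the residual drift summed over at most [n] points, the second the
    activation changes; the hypothesis reserves room so that the local iterates stay in the window
    [D]. *)
Lemma client_ideal u c r i :
  (forall r j, `|dotv (u r) (x j) - dotv (u0 r) (x j)| + 2 * K%:R * el * l1 u / sm <= D) ->
  `|dotv (iter K (local_step a x y (S c) el) u r) (x i) - dotv (u r) (x i) +
     el * K%:R / sm * (a r * \sum_(j in S c) resid u j * act u0 r j * dotv (x j) (x i))|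
  <= el * K%:R / sm * (2 * n%:R * K%:R * el * A0 u c +
       \sum_(j in S c) `|resid u j| * flip r j).
Proof.
move=> hD; rewrite local_sum_dot.
set w := fun k => iter k (local_step a x y (S c) el) u.
set T0 := a r * _.
set B := 2 * n%:R * K%:R * el * A0 u c + _.
have -> : - (el / sm * \sum_(k < K) \sum_(j in S c)
      resid (w k) j * a r * act (w k) r j * dotv (x j) (x i)) + el * K%:R / sm * T0 =
    - (el / sm * \sum_(k < K) (\sum_(j in S c)
      resid (w k) j * a r * act (w k) r j * dotv (x j) (x i) - T0)).
  rewrite sumrB sumr_const card_ord -[X in _ = - (_ * (_ - X))]mulr_natl; ring.
rewrite normrN normrM ger0_norm ?mulr_ge0 ?(ltW smV0)//.
have -> : el * K%:R / sm * B = el / sm * (K%:R * B) by ring.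
apply: ler_wpM2l; first by rewrite mulr_ge0 ?(ltW smV0).
apply: (le_trans (ler_norm_sum _ _ _)).
have -> : K%:R * B = \sum_(k < K) B by rewrite sumr_const card_ord mulr_natl.
apply: ler_sum => k _.
have [dr1 dr2] := local_drift (S c) u el0 elK (ltnW (ltn_ord k)).
have A0ge : 0 <= A0 u c by apply: sumr_ge0 => j _; exact: normr_ge0.
have A0l1 : A0 u c <= l1 u.
  rewrite /l1 (bigID (mem (S c)))/= lerDl; apply: sumr_ge0 => j _; exact: normr_ge0.
have kK : k%:R <= K%:R :> R by rewrite ler_nat ltnW.
have kA : 2 * k%:R * el * A0 u c <= 2 * K%:R * el * A0 u c.
  by apply: ler_wpM2r => //; apply: ler_wpM2r => //; rewrite ler_wpM2l.
have KA : 2 * K%:R * el * A0 u c <= 2 * K%:R * el * l1 u.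
  by apply: ler_wpM2l => //; rewrite !mulr_ge0.
rewrite /T0 mulr_sumr -sumrB.
apply: (le_trans (ler_norm_sum _ _ _)).
apply: (@le_trans _ _ (\sum_(j in S c) (2 * K%:R * el * A0 u c + `|resid u j| * flip r j))).
  apply: ler_sum => j _.
  have -> : resid (w k) j * a r * act (w k) r j * dotv (x j) (x i) -
      a r * (resid u j * act u0 r j * dotv (x j) (x i)) =
      (a r * dotv (x j) (x i)) * ((resid (w k) j - resid u j) * act (w k) r j +
        resid u j * (act (w k) r j - act u0 r j)) by ring.
  rewrite normrM normrM a1 mul1r; apply: (@le_trans _ _ (1 * _)).
    by apply: ler_wpM2r => //; exact: dotv_le1.
  rewrite mul1r; apply: (le_trans (ler_normD _ _)); rewrite !normrM; apply: lerD.
    apply: (@le_trans _ _ (`|resid (w k) j - resid u j| * 1)).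
      by apply: ler_wpM2l => //; exact: act_norm.
    by rewrite mulr1; exact: le_trans (dr2 j) kA.
  apply: ler_wpM2l => //; apply: act_flip.
  apply: le_trans (hD r j); rewrite -[dotv (w k r) _](subrK (dotv (u r) (x j))) -addrA.
  rewrite addrC; apply: (le_trans (ler_normD _ _)); rewrite lerD2l.
  apply: (le_trans (dr1 r j)); rewrite ler_pdivrMr// divfK ?gt_eqF//.
  exact: le_trans kA KA.
rewrite big_split/= lerD2r sumr_const -[leLHS]mulr_natl.
have cS : (#|S c|)%:R <= n%:R :> R by rewrite ler_nat -[leqRHS]card_ord max_card.
have -> : 2 * n%:R * K%:R * el * A0 u c = n%:R * (2 * K%:R * el * A0 u c) by ring.
by apply: ler_wpM2r => //; rewrite !mulr_ge0.
Qed.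

Lemma round_ideal u r i :
  (forall r j, `|dotv (u r) (x j) - dotv (u0 r) (x j)| + 2 * K%:R * el * l1 u / sm <= D) ->
  `|dotv (fed_round K a x y S el eg u r) (x i) - dotv (u r) (x i) +
     theta / sm * (a r * \sum_j resid u j * act u0 r j * dotv (x j) (x i))|
  <= theta / sm * (2 * n%:R * K%:R * el * l1 u + \sum_j `|resid u j| * flip r j).
Proof.
move=> hD; rewrite fed_round_dot.
have e1 (F : 'I_n -> R) (b : R) : theta / sm * (b * \sum_j F j) =
    eg * (N%:R^-1 * \sum_c (el * K%:R / sm * (b * \sum_(j in S c) F j))).
  rewrite -sum_partition -!mulr_sumr /theta; ring.
have -> : theta / sm * (2 * n%:R * K%:R * el * l1 u + \sum_j `|resid u j| * flip r j) =
    eg * (N%:R^-1 * \sum_c (el * K%:R / sm * (2 * n%:R * K%:R * el * A0 u c +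
       \sum_(j in S c) `|resid u j| * flip r j))).
  rewrite -mulr_sumr big_split/= -mulr_sumr !sum_partition /theta /l1; ring.
rewrite e1 -mulrDr -mulrDr -big_split/= !normrM ger0_norm// ger0_norm ?invr_ge0//.
apply: ler_wpM2l => //; apply: ler_wpM2l; first by rewrite invr_ge0.
apply: (le_trans (ler_norm_sum _ _ _)); apply: ler_sum => c _.
exact: client_ideal.
Qed.

Lemma gram0_resid u i : \sum_j gram0 x u0 i j * resid u j =
  m%:R^-1 * \sum_r act u0 r i * \sum_j resid u j * act u0 r j * dotv (x j) (x i).
Proof.
rewrite mulr_sumr; under [RHS]eq_bigr do rewrite !mulr_sumr.
rewrite [RHS]exchange_big/=; apply: eq_bigr => j _; rewrite mxE mulr_sumr mulr_suml.
apply: eq_bigr => r _; rewrite /act.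
have -> : dotv (x i) (x j) = dotv (x j) (x i).
  by apply: eq_bigr => k _; rewrite mulrC.
by case: (0 <= dotv (u0 r) (x i)); case: (0 <= dotv (u0 r) (x j)) => /=; ring.
Qed.

Lemma round_resid u i :
  (forall r j, `|dotv (u r) (x j) - dotv (u0 r) (x j)| + 2 * K%:R * el * l1 u / sm <= D) ->
  (forall r j, `|dotv (u r) (x j) - dotv (u0 r) (x j)| + 2 * theta * l1 u / sm <= D) ->
  (forall j, \sum_r flip r j <= nu * m%:R) ->
  `|resid (fed_round K a x y S el eg u) i - resid u i +
     theta * \sum_j gram0 x u0 i j * resid u j|
  <= theta * (5 * nu + 2 * n%:R * K%:R * el) * l1 u.
Proof.
move=> hD1 hD2 hf; set v := fed_round K a x y S el eg u.
have l10 : 0 <= l1 u by apply: sumr_ge0 => j _; exact: normr_ge0.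
pose Dl r := dotv (v r) (x i) - dotv (u r) (x i).
pose Id r := theta / sm * (a r * \sum_j resid u j * act u0 r j * dotv (x j) (x i)).
have mE : m%:R = sm * sm :> R by rewrite smm.
have sm_n0 : sm != 0 by rewrite gt_eqF.
have ar2 r : a r * a r = 1.
  by rewrite -expr2 -real_normK ?num_real// a1 expr1n.
(* Per neuron: the error of linearizing the ReLU, plus the error of replacing the true displacement
   [Dl r] by the ideal one, [- Id r]. *)
have -> : resid v i - resid u i + theta * \sum_j gram0 x u0 i j * resid u j =
   sm^-1 * \sum_r (a r * (relu (dotv (v r) (x i)) - relu (dotv (u r) (x i)) -
       act u0 r i * Dl r) + a r * (act u0 r i * (Dl r + Id r))).
  rewrite gram0_resid mE invfM /resid /net -/sm.
  have -> : forall p q s t : R, p - s - (q - s) + t = p - q + t by move=> *; ring.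
  rewrite -mulrBr -sumrB.
  rewrite [X in _ + X](_ : _ = sm^-1 * \sum_r a r * (act u0 r i * Id r)); last first.
    set Z := \sum_r _; rewrite [X in _ = _ * X](_ : _ = theta / sm * Z); first by ring.
    rewrite /Z [RHS]mulr_sumr; apply: eq_bigr => r _; rewrite /Id; set s := \sum_j _.
    have -> : a r * (act u0 r i * (theta / sm * (a r * s))) =
      (a r * a r) * (act u0 r i * (theta / sm * s)) by ring.
    by rewrite ar2; ring.
  rewrite -mulrDr -big_split/=; congr (_ * _); apply: eq_bigr => r _; ring.
rewrite normrM gtr0_norm// mulrC ler_pdivrMr//.
apply: (le_trans (ler_norm_sum _ _ _)).
pose M := 2 * n%:R * K%:R * el * l1 u.
(* The ReLU errors cost [4 * theta] per marked neuron and the displacement errors [theta]; together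
   they give the [5 * nu]. *)
apply: (@le_trans _ _ (\sum_r (flip r i * (4 * theta * l1 u / sm) +
   theta / sm * (M + \sum_j `|resid u j| * flip r j)))).
  apply: ler_sum => r _; apply: (le_trans (ler_normD _ _)).
  rewrite !(normrM (a r)) a1 !mul1r.
  have mv := fed_round_move u r i; rewrite -/v -/(Dl r) in mv.
  apply: lerD.
    apply: (le_trans (relu_flip (w := u) (v := v) _ _)).
    - apply: le_trans (hD2 r i); rewrite lerDl !mulr_ge0// ltW//.
    - apply: le_trans (hD2 r i); rewrite [leRHS]addrC.
      have -> : dotv (v r) (x i) - dotv (u0 r) (x i) =
        Dl r + (dotv (u r) (x i) - dotv (u0 r) (x i)) by rewrite /Dl; ring.
      by apply: (le_trans (ler_normD _ _)); rewrite lerD2r.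
    apply: ler_wpM2l; first exact: flip_ge0.
    have -> : 4 * theta * l1 u / sm = 2 * (2 * theta * l1 u / sm) by ring.
    by rewrite ler_wpM2l.
  rewrite normrM; apply: (@le_trans _ _ (1 * `|Dl r + Id r|)).
    by rewrite ler_wpM2r// act_norm.
  by rewrite mul1r; exact: round_ideal.
rewrite big_split/= -mulr_suml -mulr_sumr big_split/= sumr_const card_ord -[M *+ m]mulr_natl.
rewrite [X in _ + _ * (_ + X)]exchange_big/=.
have h1 : (\sum_r flip r i) * (4 * theta * l1 u / sm) <= nu * m%:R * (4 * theta * l1 u / sm).
  by apply: ler_wpM2r => //; rewrite !mulr_ge0// ltW.
have h2 : \sum_j \sum_r `|resid u j| * flip r j <= nu * m%:R * l1 u.
  rewrite /l1 [leRHS]mulr_sumr; apply: ler_sum => j _; rewrite -mulr_sumr mulrC.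
  by rewrite ler_wpM2r.
have h3 : theta / sm * (m%:R * M + \sum_j \sum_r `|resid u j| * flip r j) <=
   theta / sm * (m%:R * M + nu * m%:R * l1 u).
  by apply: ler_wpM2l; [rewrite !mulr_ge0// ltW|rewrite lerD2l].
apply: (le_trans (lerD h1 h3)).
rewrite /M mE le_eqVlt; apply/orP; left; apply/eqP.
by field.
Qed.

(** * Contraction of the squared error and induction over the rounds *)

Lemma sqr_sum_norm_le (I : finType) (F : I -> R) :
  (\sum_i `|F i|) ^+ 2 <= #|I|%:R * \sum_i F i ^+ 2.
Proof.
set e := \sum_i `|F i|; set q := \sum_i F i ^+ 2; set N' : R := #|I|%:R.
have [/card0_eq I0|Ipos] := posnP #|I|.
  have -> : e = 0 by rewrite /e big_pred0.
  by rewrite expr0n mulr_ge0// sumr_ge0// => i _; exact: sqr_ge0.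
have N0' : 0 < N' by rewrite ltr0n.
(* Cauchy-Schwarz as nonnegativity of an unnormalized variance of the [|F i|]. *)
have : 0 <= \sum_i (N' * `|F i| - e) ^+ 2 by apply: sumr_ge0 => i _; exact: sqr_ge0.
have -> : \sum_i (N' * `|F i| - e) ^+ 2 = N' * (N' * q - e ^+ 2).
  transitivity (\sum_i (N' ^+ 2 * F i ^+ 2 - 2 * N' * e * `|F i| + e ^+ 2)).
    by apply: eq_bigr => i _; rewrite -(real_normK (num_real (F i))); ring.
  rewrite !big_split/= sumrN -!mulr_sumr -/q -/e sumr_const -[_ *+ _]mulr_natl -/N'; ring.
by rewrite pmulr_rge0// subr_ge0.
Qed.

(** In units of [th * lam * s2], expanding the square gives -2 from the main term, at most 14/20
    from the cross term with the error, and at most 4/20 from the second-order term. The total lies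
    below the -1/2 that is claimed. *)
Lemma contraction_step (e e' g : 'I_n -> R) (th q lam : R) :
  let s2 := \sum_i e i ^+ 2 in let s1 := \sum_i `|e i| in
  0 <= th -> 0 <= q -> q <= 1 -> 0 <= lam ->
  th * n%:R ^+ 2 <= lam / 20 -> q * n%:R <= lam * 7 / 20 ->
  (forall i, `|e' i - e i + th * g i| <= th * q * s1) ->
  (forall i, `|g i| <= s1) -> lam * s2 <= \sum_i e i * g i ->
  \sum_i e' i ^+ 2 <= (1 - th * lam / 2) * s2.
Proof.
move=> s2 s1 th0 q0 q1 lam0 thn qn he hg hlam.
have s10 : 0 <= s1 by apply: sumr_ge0 => i _.
have s20 : 0 <= s2 by apply: sumr_ge0 => i _; exact: sqr_ge0.
have cs : s1 ^+ 2 <= n%:R * s2 by have := sqr_sum_norm_le e; rewrite card_ord.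
pose dl i := e' i - e i + th * g i.
have E i : e' i ^+ 2 <= e i ^+ 2 - 2 * th * (e i * g i) + 2 * (th * q * s1) * `|e i| +
    4 * th ^+ 2 * s1 ^+ 2.
  have -> : e' i ^+ 2 = e i ^+ 2 - 2 * th * (e i * g i) + 2 * (e i * dl i) +
    (dl i - th * g i) ^+ 2 by rewrite /dl; ring.
  apply: lerD.
    rewrite lerD2l -mulrA ler_pM2l ?ltr0n//; apply: (le_trans (ler_norm _)).
    by rewrite normrM mulrC; apply: ler_wpM2r => //; exact: he.
  have -> : 4 * th ^+ 2 * s1 ^+ 2 = (2 * th * s1) ^+ 2 by ring.
  rewrite -[leLHS](real_normK (num_real _)) ler_pXn2r ?nnegrE ?mulr_ge0//.
  apply: (le_trans (ler_normB _ _)).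
  have := he i; rewrite -/(dl i) normrM (ger0_norm th0) => h1.
  have h2 : th * `|g i| <= th * s1 by apply: ler_wpM2l.
  have h3 : th * q * s1 <= th * s1 by rewrite ler_wpM2r// ler_piMr.
  lra.
apply: (le_trans (ler_sum _ (fun i _ => E i))).
rewrite !big_split/= sumrN -!mulr_sumr -/s2 -/s1 sumr_const card_ord -[_ *+ n]mulr_natl.
have b1 : th * lam * s2 <= th * \sum_i e i * g i by rewrite -mulrA ler_wpM2l.
have b2 : th * q * s1 ^+ 2 <= th * (lam * 7 / 20) * s2.
  apply: (@le_trans _ _ (th * q * (n%:R * s2))); first by rewrite ler_wpM2l ?mulr_ge0.
  have -> : th * q * (n%:R * s2) = th * (q * n%:R) * s2 by ring.
  by apply: ler_wpM2r => //; apply: ler_wpM2l.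
have b3 : th ^+ 2 * (n%:R * s1 ^+ 2) <= th * (lam / 20) * s2.
  apply: (@le_trans _ _ (th ^+ 2 * (n%:R * (n%:R * s2)))).
    by apply: ler_wpM2l; [exact: sqr_ge0|exact: ler_wpM2l].
  have -> : th ^+ 2 * (n%:R * (n%:R * s2)) = th * (th * n%:R ^+ 2) * s2 by ring.
  by apply: ler_wpM2r => //; apply: ler_wpM2l.
have b4 : 0 <= th * lam * s2 by rewrite !mulr_ge0.
nra.
Qed.

Lemma gram0_le1 i j : `|gram0 x u0 i j| <= 1.
Proof.
rewrite mxE normrM ger0_norm ?invr_ge0// mulrC ler_pdivrMr ?ltr0n// mul1r.
apply: (le_trans (ler_norm_sum _ _ _)); rewrite -[leRHS]mulr1.
apply: sumr_cst_le => r; rewrite normrM; apply: mulr_ile1 => //; first exact: dotv_le1.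
by case: ifP => _; rewrite ?normr1 ?normr0 ?lexx ?ler01.
Qed.

(** The invariant bounds the displacement so far by [Q] times the decrease of the residual norm
    [Ew]. A round moves a preactivation by at most [2 * theta * B * Ew], which equals
    [Q * (theta * lam / 4) * Ew], and the norm drops by at least [theta * lam / 4 * Ew]. The bounds
    telescope, so no geometric series is summed, and the total displacement stays below
    [Q * Ew u0 <= D]. *)
Lemma fed_convergence (lam : R) :
  (0 < n)%N -> 0 < lam <= 1 -> eg <= 1 ->
  el * K%:R * n%:R ^+ 2 <= lam / 20 -> 0 <= nu -> nu * n%:R <= lam / 20 ->
  (forall v : 'I_n -> R, lam * \sum_i v i ^+ 2 <=
     \sum_i v i * \sum_j gram0 x u0 i j * v j) ->
  (forall j, \sum_r flip r j <= nu * m%:R) ->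
  8 * Num.sqrt n%:R * Num.sqrt (sq_err a x y u0) / (lam * sm) <= D ->
  forall t, sq_err a x y (fed_iter K a x y S el eg u0 t) <=
    (1 - eg * el * lam * K%:R / (2 * N%:R)) ^+ t * sq_err a x y u0.
Proof.
move=> n0 /andP[lam0 lam1] eg1 elKn nu0 nun hquad hflip hD.
set u := fed_iter K a x y S el eg u0.
have uS t : u t.+1 = fed_round K a x y S el eg (u t) by [].
have sqE w : sq_err a x y w = \sum_i resid w i ^+ 2 by [].
pose E t := Num.sqrt (sq_err a x y (u t)).
pose B : R := Num.sqrt n%:R / sm.
have B0 : 0 <= B by rewrite mulr_ge0 ?sqrtr_ge0 ?(ltW smV0).
have n1 : 1 <= n%:R :> R by rewrite ler1n.
have N1 : 1 <= N%:R :> R by rewrite ler1n.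
have elK0 : 0 <= el * K%:R by rewrite mulr_ge0.
have elKl : el * K%:R <= lam / 20.
  apply: le_trans elKn; rewrite ler_peMr// expr_ge1//.
have theta_le : theta <= el * K%:R.
  rewrite /theta ler_pdivrMr ?ltr0n// -mulrA.
  apply: (@le_trans _ _ (1 * (el * K%:R))); first by rewrite ler_wpM2r.
  by rewrite mul1r ler_peMr.
have rate : 1 - eg * el * lam * K%:R / (2 * N%:R) = 1 - theta * lam / 2.
  by rewrite /theta; field; rewrite gt_eqF// ltr0n.
rewrite rate.
have sq0 w : 0 <= sq_err a x y w by apply: sumr_ge0 => i _; exact: sqr_ge0.
have l1B w : l1 w / sm <= B * Num.sqrt (sq_err a x y w).
  rewrite /B mulrAC ler_pM2r// -(@ler_pXn2r _ 2) ?nnegrE ?mulr_ge0 ?sqrtr_ge0//; last first.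
    by apply: sumr_ge0 => j _.
  rewrite exprMn !sqr_sqrtr//; have := sqr_sum_norm_le (resid w); by rewrite card_ord.
have hD' : 8 * B / lam * E 0%N <= D.
  apply: le_trans hD; rewrite le_eqVlt; apply/orP; left; apply/eqP.
  by rewrite /B /E /u /=; field; rewrite !gt_eqF.
have tl1 : theta * lam <= 1.
  have : theta * lam <= 1 * 1 by apply: ler_pM => //; [exact: ltW|lra].
  lra.
pose Q := 8 * B / lam.
have Q0 : 0 <= Q by rewrite !mulr_ge0// invr_ge0 ltW.
pose Ew w := Num.sqrt (sq_err a x y w).
have Ew0 w : 0 <= Ew w by exact: sqrtr_ge0.
have step w : (forall r i, `|dotv (w r) (x i) - dotv (u0 r) (x i)| <= Q * (Ew u0 - Ew w)) ->
    let v := fed_round K a x y S el eg w in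
    sq_err a x y v <= (1 - theta * lam / 2) * sq_err a x y w /\
    (forall r i, `|dotv (v r) (x i) - dotv (u0 r) (x i)| <= Q * (Ew u0 - Ew v)).
  move=> hw v.
  (* The unspent budget [Q * Ew w] covers one further move. This is used with [z = el * K] for the
     local steps and with [z = theta] for the whole round. *)
  have QlE (z : R) : 0 <= z -> z <= 1 -> 2 * z * (B * Ew w) <= Q * Ew w.
    move=> z0 z1; rewrite /Q.
    have -> : 2 * z * (B * Ew w) = 2 * z * lam * (B * Ew w / lam) by field; rewrite gt_eqF.
    have -> : 8 * B / lam * Ew w = 8 * (B * Ew w / lam) by ring.
    apply: ler_wpM2r; first by rewrite !mulr_ge0// invr_ge0 ltW.
    have : z * lam <= 1 * 1 by apply: ler_pM => //; exact: ltW.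
    lra.
  have bnd (z : R) : 0 <= z -> z <= 1 -> forall r i,
      `|dotv (w r) (x i) - dotv (u0 r) (x i)| + 2 * z * l1 w / sm <= D.
    move=> z0 z1 r i; apply: le_trans hD'.
    have h1 := hw r i.
    have h2 : 2 * z * l1 w / sm <= Q * Ew w.
      apply: le_trans (QlE z z0 z1); rewrite -mulrA.
      by apply: ler_wpM2l; [rewrite mulr_ge0|exact: l1B].
    rewrite -/Q; have -> : E 0%N = Ew u0 by []. lra.
  have hD1 r i : `|dotv (w r) (x i) - dotv (u0 r) (x i)| + 2 * K%:R * el * l1 w / sm <= D.
    have -> : 2 * K%:R * el = 2 * (el * K%:R) by ring.
    by apply: bnd => //; lra.
  have hD2 r i : `|dotv (w r) (x i) - dotv (u0 r) (x i)| + 2 * theta * l1 w / sm <= D.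
    by apply: bnd => //; lra.
  have sqv : sq_err a x y v <= (1 - theta * lam / 2) * sq_err a x y w.
    rewrite !sqE; apply: (@contraction_step (resid w) (resid v)
      (fun i => \sum_j gram0 x u0 i j * resid w j) theta (5 * nu + 2 * n%:R * K%:R * el)).
    - exact: theta0.
    - by rewrite addr_ge0 ?mulr_ge0.
    - have h1 : nu <= lam / 20 by apply: le_trans nun; rewrite ler_peMr.
      have : n%:R * (el * K%:R) <= lam / 20.
        apply: le_trans elKn; rewrite mulrC ler_wpM2l// expr2 ler_peMr//; lra.
      nra.
    - exact: ltW.
    - by apply: le_trans elKn; rewrite ler_wpM2r// exprn_ge0.
    - have -> : (5 * nu + 2 * n%:R * K%:R * el) * n%:R =
        5 * (nu * n%:R) + 2 * (el * K%:R * n%:R ^+ 2) by ring.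
      lra.
    - by move=> i; exact: round_resid.
    - move=> i; apply: (le_trans (ler_norm_sum _ _ _)); apply: ler_sum => j _.
      by rewrite normrM ler_piMl// gram0_le1.
    - exact: hquad.
  split=> // r i.
  (* Taking roots: [(1 - theta * lam / 4) ^+ 2] dominates [1 - theta * lam / 2]. *)
  have Ev : Ew v <= (1 - theta * lam / 4) * Ew w.
    have c0 : 0 <= 1 - theta * lam / 4 by lra.
    rewrite /Ew -(@ler_pXn2r _ 2) ?nnegrE ?mulr_ge0 ?sqrtr_ge0// exprMn !sqr_sqrtr//.
    apply: (le_trans sqv); apply: ler_wpM2r => //; nra.
  have mv := fed_round_move w r i; rewrite -/v in mv.
  have h2 : 2 * theta * l1 w / sm <= 2 * theta * (B * Ew w).
    by rewrite -mulrA; apply: ler_wpM2l; [rewrite mulr_ge0|exact: l1B].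
  have h3 : 2 * theta * (B * Ew w) = Q * (theta * lam / 4 * Ew w).
    by rewrite /Q; field; rewrite gt_eqF.
  have h4 : Q * (theta * lam / 4 * Ew w) <= Q * (Ew w - Ew v).
    by apply: ler_wpM2l => //; lra.
  have h1 := hw r i.
  have -> : dotv (v r) (x i) - dotv (u0 r) (x i) =
    (dotv (v r) (x i) - dotv (w r) (x i)) + (dotv (w r) (x i) - dotv (u0 r) (x i)) by ring.
  apply: (le_trans (ler_normD _ _)); nra.
have inv t : (forall r i, `|dotv (u t r) (x i) - dotv (u0 r) (x i)| <= Q * (Ew u0 - Ew (u t))) /\
    sq_err a x y (u t) <= (1 - theta * lam / 2) ^+ t * sq_err a x y u0.
  elim: t => [|t [IH1 IH2]].
    split; last by rewrite expr0 mul1r.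
    by move=> r i; rewrite /u /fed_iter /= !subrr normr0 mulr0.
  have [s1 s2] := step _ IH1; split; first exact: s2.
  rewrite uS exprS -mulrA; apply: (le_trans s1); apply: ler_wpM2l => //; lra.
by move=> t; have [] := inv t.
Qed.

End Deterministic.

(** * Independence *)

Section independence.
Context d (T : measurableType d) (R : realType) (P : probability T R).

(** Both sides are finite measures in [E] that agree on the pi-system [G], hence on the
    sigma-algebra it generates. *)
Lemma dynkin_indep (Q : set T) (G : set (set T)) :
  measurable Q -> setI_closed G -> G setT -> G `<=` measurable ->
  (forall E, G E -> P (Q `&` E) = (P Q * P E)%E) ->
  forall E, <<s G >> E -> P (Q `&` E) = (P Q * P E)%E.
Proof.
move=> mQ GI GT Gm GE E sE.
pose m1 : {measure set T -> \bar R} := mrestr P mQ.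
have PQ0 : 0 <= fine (P Q) by rewrite fine_ge0.
pose m2 : {measure set T -> \bar R} := mscale (NngNum PQ0) P.
have m1E A : m1 A = P (Q `&` A) by rewrite /m1 /= /mrestr setIC.
have m2E A : m2 A = (P Q * P A)%E.
  by rewrite /m2 /= /mscale /= fineK// fin_num_measure.
rewrite -m1E -m2E.
apply: (g_sigma_algebra_measure_unique G Gm (fun=> setT)) => //.
- by rewrite bigcup_const//; exists 0%N.
- by move=> A GA; rewrite m1E m2E GE.
- by move=> _; rewrite m1E setIT; apply: (le_lt_trans (probability_le1 P mQ)); rewrite ltry.
Qed.

Variables (I : finType) (X : I -> T -> R).
Hypothesis mX : forall i, measurable_fun setT (X i).
Hypothesis indX : mutually_independent P X.

(** Cylinders over the coordinates in [J]. Constraining all these coordinates at once makes the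
    family a pi-system, and it generates the sigma-algebra of the block [J]. *)
Definition cyl (J : I -> bool) : set (set T) :=
  [set E | exists2 B : I -> set R, (forall i, measurable (B i)) &
    E = \bigcap_(i in [set i | J i]) X i @^-1` B i].

Lemma measurable_preimX i (B : set R) : measurable B -> measurable (X i @^-1` B).
Proof. by move=> mB; rewrite -[_ @^-1` _]setTI; exact: mX. Qed.

Lemma cylI J : setI_closed (cyl J).
Proof.
move=> _ _ [B mB ->] [C mC ->]; exists (fun i => B i `&` C i).
  by move=> i; exact: measurableI.
by rewrite -bigcapI; apply: eq_bigcapr => i _; rewrite preimage_setI.
Qed.

Lemma cylT J : cyl J setT.
Proof.
exists (fun=> setT) => //.
by apply/esym; rewrite -subTset => x _ i _.
Qed.

Lemma cyl_sub (J J' : I -> bool) : (forall i, J i -> J' i) -> cyl J `<=` cyl J'.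
Proof.
move=> JJ' _ [B mB ->]; exists (fun i => if J i then B i else setT).
  by move=> i; case: ifP.
apply/seteqP; split => x xB i /=.
  by move=> _; case: ifP => // Ji; exact: xB.
by move=> Ji; have := xB i (JJ' _ Ji); rewrite /= Ji.
Qed.

Lemma cyl_measurable J : cyl J `<=` measurable.
Proof.
move=> _ [B mB ->]; apply: fin_bigcap_measurable => //.
by move=> i _; exact: measurable_preimX.
Qed.

Lemma sigma_cyl_measurable J : <<s cyl J >> `<=` measurable.
Proof.
apply: smallest_sub; first exact: sigma_algebra_measurable.
exact: cyl_measurable.
Qed.

(** Independence is assumed only for intersections over the full index set, so the coordinates
    outside [J] are filled with [setT], of probability 1. *)
Lemma cyl_full (J : I -> bool) (B : I -> set R) : (forall i, measurable (B i)) ->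
  P (\bigcap_(i in [set i | J i]) X i @^-1` B i) =
  (\prod_i (if J i then P (X i @^-1` B i) else 1))%E.
Proof.
move=> mB; pose C i := if J i then B i else setT.
have -> : \bigcap_(i in [set i | J i]) X i @^-1` B i =
          \bigcap_(i in [set: I]) X i @^-1` C i.
  apply/seteqP; split => x xB i /=; rewrite /C.
    by move=> _; case: ifP => // Ji; exact: xB.
  by move=> Ji; have := xB i Logic.I; rewrite /C /= Ji.
rewrite indX; last by move=> i; rewrite /C; case: ifP.
apply: eq_bigr => i _; rewrite /C; case: ifP => // _.
by rewrite preimage_setT probability_setT.
Qed.

Lemma cyl_indep (J1 J2 : I -> bool) : (forall i, J1 i -> J2 i -> False) ->
  forall E F, cyl J1 E -> cyl J2 F -> P (E `&` F) = (P E * P F)%E.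
Proof.
move=> J12 _ _ [B mB ->] [C mC ->].
have -> : \bigcap_(i in [set i | J1 i]) X i @^-1` B i `&`
          \bigcap_(i in [set i | J2 i]) X i @^-1` C i =
  \bigcap_(i in [set i | (J1 i || J2 i)%B]) X i @^-1` (if J1 i then B i else C i).
  apply/seteqP; split => [x [xB xC] i /=|x h].
    case: ifPn => [Ji _|_ /= Ji]; [exact: xB|exact: xC].
  split=> i /= Ji; have := h i; rewrite /= Ji ?orbT => /(_ isT) //.
  by case: ifPn => // /J12 /(_ Ji).
rewrite !cyl_full//; last by move=> i; case: ifP.
rewrite -big_split/=; apply: eq_bigr => i _.
case: (boolP (J1 i)) => [/J12 h|_] /=.
  by case: ifPn => [/h//|_]; rewrite mule1.
by rewrite mul1e.
Qed.

(** The Dynkin argument is applied once per side: cylinders of [J1] are extended with [F] fixed,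
    then those of [J2] with a cylinder fixed. *)
Lemma sigma_indep (J1 J2 : I -> bool) : (forall i, J1 i -> J2 i -> False) ->
  forall E F, <<s cyl J1 >> E -> <<s cyl J2 >> F -> P (E `&` F) = (P E * P F)%E.
Proof.
move=> J12 E F sE sF.
have mF : measurable F by exact: sigma_cyl_measurable sF.
rewrite setIC muleC.
apply: (@dynkin_indep F (cyl J1)) => //; [exact: cylI|exact: cylT|exact: cyl_measurable|].
move=> {sE}E cE.
have mE : measurable E by exact: cyl_measurable cE.
rewrite setIC muleC.
apply: (@dynkin_indep E (cyl J2)) => //; [exact: cylI|exact: cylT|exact: cyl_measurable|].
by move=> {mF sF}F cF; exact: (cyl_indep J12).
Qed.

(** Expresses that [W] depends only on the coordinates in [J]. Being measurability for a generated
    sigma-algebra, it inherits the closure properties of measurable functions. *)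
Definition mfun_on (J : I -> bool) (W : T -> R) :=
  measurable_fun setT (W : g_sigma_algebraType (cyl J) -> R).

Lemma mfun_on_preim J W (B : set R) : mfun_on J W -> measurable B ->
  <<s cyl J >> (W @^-1` B).
Proof. by move=> mW mB; have := mW measurableT B mB; rewrite setTI. Qed.

Lemma mfun_onT J W : mfun_on J W -> measurable_fun setT W.
Proof.
move=> mW _ B mB; rewrite setTI; apply: (@sigma_cyl_measurable J).
exact: mfun_on_preim.
Qed.

Lemma mfun_on_sub (J J' : I -> bool) W : (forall i, J i -> J' i) ->
  mfun_on J W -> mfun_on J' W.
Proof.
move=> JJ' mW _ B mB; rewrite setTI.
have : <<s cyl J >> `<=` <<s cyl J' >>.
  by apply: sub_smallest2r; [exact: smallest_sigma_algebra|exact: (cyl_sub JJ')].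
by apply; exact: mfun_on_preim.
Qed.

Lemma mfun_on_coord (J : I -> bool) i : J i -> mfun_on J (X i).
Proof.
move=> Ji _ B mB; rewrite setTI; apply: sub_sigma_algebra.
exists (fun j => if j == i then B else setT); first by move=> j; case: ifP.
apply/seteqP; split => x /= h.
  by move=> j /= _; case: eqP => [->|].
by have := h i Ji; rewrite /= eqxx.
Qed.

Lemma mfun_on_indep (J1 J2 : I -> bool) (W Z : T -> R) :
  (forall i, J1 i -> J2 i -> False) -> mfun_on J1 W -> mfun_on J2 Z ->
  forall A B, measurable A -> measurable B ->
  P (W @^-1` A `&` Z @^-1` B) = (P (W @^-1` A) * P (Z @^-1` B))%E.
Proof.
move=> J12 mW mZ A B mA mB.
by apply: (sigma_indep J12); exact: mfun_on_preim.
Qed.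

End independence.

(** * Expectations of independent variables *)

Lemma pair_integral d d1 d2 (T : measurableType d) (T1 : measurableType d1)
  (T2 : measurableType d2) (R : realType) (P : probability T R)
  (X : T -> T1) (Y : T -> T2) (G : T1 * T2 -> \bar R) :
  measurable_fun setT X -> measurable_fun setT Y -> measurable_fun setT G ->
  (forall z, 0 <= G z)%E ->
  (forall A B, measurable A -> measurable B ->
    P (X @^-1` A `&` Y @^-1` B) = (P (X @^-1` A) * P (Y @^-1` B))%E) ->
  (\int[P]_w G (X w, Y w) = \int[P]_w \int[P]_w' G (X w, Y w'))%E.
Proof.
move=> mX mY mG G0 ind.
pose Xr : {RV P >-> T1} := HB.pack X (isMeasurableFun.Build _ _ _ _ X mX).
pose Yr : {RV P >-> T2} := HB.pack Y (isMeasurableFun.Build _ _ _ _ Y mY).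
have mXY : measurable_fun setT (fun w => (X w, Y w)) by exact/measurable_fun_pair.
pose XYr : {RV P >-> (T1 * T2)%type} :=
  HB.pack (fun w => (X w, Y w)) (isMeasurableFun.Build _ _ _ _ _ mXY).
transitivity (\int[distribution P XYr]_z G z)%E.
  by rewrite ge0_integral_distribution.
transitivity (\int[(distribution P Xr \x distribution P Yr)%E]_z G z)%E.
  (* Independence says that the joint law agrees with the product measure on rectangles, and a
     product measure is determined by them. *)
  apply: eq_measure_integral => A mA _.
  apply/esym.
  by apply: (product_measure_unique (m1 := distribution P Xr) (m2 := distribution P Yr)).
rewrite fubini_tonelli1//.
rewrite ge0_integral_distribution//=; last 2 first.
  exact: measurable_fun_fubini_tonelli_F.
  by move=> y; apply: integral_ge0.
apply: eq_integral => w _; rewrite /fubini_F.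
rewrite ge0_integral_distribution//.
exact: measurableT_comp.
Qed.

Lemma law_integral d d1 (T : measurableType d) (T1 : measurableType d1) (R : realType)
  (P : probability T R) (X : T -> T1) (nu : {measure set T1 -> \bar R}) (f : T1 -> \bar R) :
  measurable_fun setT X -> (forall B, measurable B -> P (X @^-1` B) = nu B) ->
  measurable_fun setT f -> (forall t, 0 <= f t)%E ->
  (\int[P]_w f (X w) = \int[nu]_t f t)%E.
Proof.
move=> mX law mf f0.
pose Xr : {RV P >-> T1} := HB.pack X (isMeasurableFun.Build _ _ _ _ X mX).
rewrite -(ge0_integral_distribution Xr mf f0).
by apply: eq_measure_integral => B mB _; exact: law.
Qed.

Section expectation_products.
Context d (T : measurableType d) (R : realType) (P : probability T R).
Variables (I : finType) (X : I -> T -> R).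
Hypothesis mX : forall i, measurable_fun setT (X i).
Hypothesis indX : mutually_independent P X.

Lemma expectation_mul_indep (J1 J2 : I -> bool) (W Z : T -> R) :
  (forall i, J1 i -> J2 i -> False) -> mfun_on X J1 W -> mfun_on X J2 Z ->
  (forall w, 0 <= W w) -> (forall w, 0 <= Z w) ->
  (\int[P]_w (W w * Z w)%:E = \int[P]_w (W w)%:E * \int[P]_w (Z w)%:E)%E.
Proof.
move=> J12 mW mZ W0 Z0.
have mW' := mfun_onT mX mW; have mZ' := mfun_onT mX mZ.
(* The absolute values make [G] nonnegative on the whole plane; they disappear on the nonnegative
   [W] and [Z]. *)
pose G (z : R * R) := (`|z.1| * `|z.2|)%:E.
have := pair_integral (P := P) (X := W) (Y := Z) (G := G) mW' mZ'.
have mG : measurable_fun setT G.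
  apply/measurable_EFinP; apply: measurable_funM.
    by apply: measurableT_comp => //; exact: measurable_fst.
  by apply: measurableT_comp => //; exact: measurable_snd.
have G0 z : (0 <= G z)%E by rewrite lee_fin mulr_ge0.
move=> /(_ mG G0 (mfun_on_indep mX indX J12 mW mZ)).
under eq_integral do rewrite /G/= !ger0_norm//.
move=> ->.
have mWE : measurable_fun setT (fun w => (W w)%:E) by exact/measurable_EFinP.
have mZE : measurable_fun setT (fun w => (Z w)%:E) by exact/measurable_EFinP.
have W0E w : (0 <= (W w)%:E)%E by rewrite lee_fin.
have Z0E w : (0 <= (Z w)%:E)%E by rewrite lee_fin.
transitivity (\int[P]_w ((W w)%:E * \int[P]_v (Z v)%:E))%E.
  apply: eq_integral => w _.
  rewrite -(ge0_integralZl P measurableT mZE (fun v _ => Z0E v) (W0E w)).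
  by apply: eq_integral => v _; rewrite /G/= !ger0_norm// EFinM.
by rewrite (ge0_integralZr P measurableT mWE (fun v _ => W0E v))// integral_ge0.
Qed.

Lemma expectation_prod (K : finType) (J : K -> I -> bool) (W : K -> T -> R) :
  (forall k k' i, J k i -> J k' i -> k = k') ->
  (forall k, mfun_on X (J k) (W k)) -> (forall k w, 0 <= W k w) ->
  (\int[P]_w (\prod_k W k w)%:E = \prod_k \int[P]_w (W k w)%:E)%E.
Proof.
move=> Jdisj mW W0.
(* A partial product depends only on the union of the blocks used so far, which is disjoint from the
   block of the next factor. *)
have mP (s : seq K) : mfun_on X (fun i => has (J ^~ i) s) (fun w => \prod_(k <- s) W k w).
  elim: s => [|k s IH].
    have -> : (fun w => \prod_(k <- [::]) W k w) = cst 1.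
      by apply/funext => w; rewrite big_nil.
    exact: measurable_cst.
  have -> : (fun w => \prod_(j <- k :: s) W j w) = (fun w => W k w * \prod_(j <- s) W j w).
    by apply/funext => w; rewrite big_cons.
  apply: measurable_funM.
    by apply: mfun_on_sub (mW k) => // i Ji /=; rewrite Ji.
  by apply: mfun_on_sub IH => // i Ji /=; rewrite Ji orbT.
have main (s : seq K) : uniq s ->
    (\int[P]_w (\prod_(k <- s) W k w)%:E = \prod_(k <- s) \int[P]_w (W k w)%:E)%E.
  elim: s => [_|k s IH /= /andP[ks us]].
    rewrite big_nil (eq_integral (cst 1%E)); last by move=> w _; rewrite big_nil.
    by rewrite integral_cst// mul1e; exact: probability_setT.
  rewrite big_cons -IH//.
  rewrite (eq_integral (fun w => (W k w * \prod_(j <- s) W j w)%:E)); last first.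
    by move=> w _; rewrite big_cons.
  apply: (expectation_mul_indep (J1 := J k) (J2 := fun i => has (J ^~ i) s)) => //.
    move=> i Jki /hasP[k' k's Jk'i]; move: ks; rewrite (Jdisj _ _ _ Jki Jk'i).
    by rewrite k's.
  by move=> w; apply: prodr_ge0 => k' _.
by apply: main; exact: index_enum_uniq.
Qed.

End expectation_products.

(** * Gaussian integrals *)

Section gaussian.
Context {R : realType}.
Local Notation mu := (@lebesgue_measure R).

(** The change of variables is available for the Radon-Nikodym derivative, which coincides almost
    everywhere with the explicit density because the two have equal integrals on measurable sets. *)
Lemma ge0_integral_normal_prob (f : R -> \bar R) : measurable_fun setT f ->
  (forall t, 0 <= f t)%E ->
  (\int[normal_prob 0 1]_t f t = \int[mu]_t (f t * (normal_pdf 0 1 t)%:E))%E.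
Proof.
move=> mf f0.
have dom := @normal_prob_dominates R 0 1.
rewrite -(Radon_Nikodym_SigmaFinite.change_of_variables dom f0 measurableT mf).
apply: ae_eq_integral => //.
- apply: emeasurable_funM => //.
  exact: measurable_int (Radon_Nikodym_SigmaFinite.f_integrable dom).
- apply: emeasurable_funM => //; apply/measurable_EFinP.
  exact: measurable_normal_pdf.
- apply: ae_eqe_mul2l; apply: integral_ae_eq => //.
  + exact: Radon_Nikodym_SigmaFinite.f_integrable.
  + by apply/measurable_EFinP; exact: measurable_normal_pdf.
  + by move=> E _ mE; rewrite -(Radon_Nikodym_SigmaFinite.f_integral dom).
Qed.

(** Completing the square turns the tilted density into [expR (s ^+ 2 / 2)] times the density of
    mean [s]. *)
Lemma normal_mgf (s : R) :
  (\int[normal_prob 0 1]_t (expR (s * t))%:E = (expR (s ^+ 2 / 2))%:E)%E.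
Proof.
rewrite ge0_integral_normal_prob//; last first.
  by apply/measurable_EFinP; apply: measurableT_comp => //; exact: measurable_funM.
transitivity (\int[mu]_t ((expR (s ^+ 2 / 2))%:E * (normal_pdf s 1 t)%:E))%E.
  apply: eq_integral => t _; rewrite -!EFinM; congr EFin.
  rewrite !normal_pdfE ?oner_neq0// /normal_fun mulrCA [RHS]mulrCA -!expRD.
  by congr (_ * expR _); field.
rewrite ge0_integralZl//; first by rewrite integral_normal_pdf mule1.
- by apply/measurable_EFinP; exact: measurable_normal_pdf.
- by move=> t _; rewrite lee_fin normal_pdf_ge0.
Qed.

(* One step of the recursion [V |-> V + b ^+ 2] for [E exp (- (sum_k b_k g_k) ^+ 2 / (2 V))]. *)
Lemma normal_gauss_conv (V b s : R) : 0 < V ->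
  (\int[normal_prob 0 1]_t (expR (- (s + b * t) ^+ 2 / (2 * V)))%:E =
   (Num.sqrt (V / (V + b ^+ 2)) * expR (- s ^+ 2 / (2 * (V + b ^+ 2))))%:E)%E.
Proof.
move=> V0.
have Vb : 0 < V + b ^+ 2 by rewrite ltr_wpDr// sqr_ge0.
rewrite ge0_integral_normal_prob//; last first.
  apply/measurable_EFinP; apply: measurableT_comp => //.
  apply: measurable_funM => //; apply: measurableT_comp => //.
  by apply: measurable_funX; apply: measurable_funD => //; exact: measurable_funM.
pose sg := Num.sqrt (V / (V + b ^+ 2)).
have sg0 : 0 < sg by rewrite sqrtr_gt0 divr_gt0.
have sg2 : sg ^+ 2 = V / (V + b ^+ 2) by rewrite sqr_sqrtr// ltW// divr_gt0.
have sgn0 : sg != 0 by rewrite gt_eqF.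
(* Mean of the Gaussian in [t] obtained by completing the square; [sg] is its standard deviation. *)
pose M := - (s * b) / (V + b ^+ 2).
rewrite -/sg.
transitivity (\int[mu]_t ((sg * expR (- s ^+ 2 / (2 * (V + b ^+ 2))))%:E *
    (normal_pdf M sg t)%:E))%E.
  apply: eq_integral => t _; rewrite -!EFinM; congr EFin.
  rewrite !normal_pdfE ?oner_neq0// /normal_fun.
  have -> : normal_peak sg = normal_peak 1 / sg.
    rewrite /normal_peak expr1n mul1r -invfM; congr (_^-1).
    rewrite -mulrnAr sqrtrM ?sqr_ge0// sqrtr_sqr gtr0_norm// mulrC.
    by rewrite -mulr_natl mulrC.
  rewrite mulrCA.
  have -> : sg * expR (- s ^+ 2 / (2 * (V + b ^+ 2))) *
      (normal_peak 1 / sg * expR (- (t - M) ^+ 2 / (sg ^+ 2 *+ 2))) =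
      normal_peak 1 * (expR (- s ^+ 2 / (2 * (V + b ^+ 2))) *
      expR (- (t - M) ^+ 2 / (sg ^+ 2 *+ 2))).
    by field.
  rewrite -!expRD sg2; congr (_ * expR _); rewrite /M.
  by field; rewrite !gt_eqF.
rewrite ge0_integralZl//; first by rewrite integral_normal_pdf mule1.
- by apply/measurable_EFinP; exact: measurable_normal_pdf.
- by move=> t _; rewrite lee_fin normal_pdf_ge0.
- by rewrite lee_fin mulr_ge0 ?expR_ge0// ltW.
Qed.

End gaussian.

(** * The random initialization *)

Lemma measurable_ge dT (T : measurableType dT) (R : realType) (f : T -> R) (b : R) :
  measurable_fun setT f ->
  measurable [set w | b <= f w].
Proof.
move=> mf; have -> : [set w | b <= f w] = f @^-1` `[b, +oo[.
  by apply/seteqP; split => w /=; rewrite in_itv /= andbT.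
by rewrite -[X in measurable X]setTI; exact: mf.
Qed.

Lemma measurable_lt dT (T : measurableType dT) (R : realType) (f : T -> R) (b : R) :
  measurable_fun setT f ->
  measurable [set w | f w < b].
Proof.
move=> mf; have -> : [set w | f w < b] = f @^-1` `]-oo, b[.
  by apply/seteqP; split => w /=; rewrite in_itv.
by rewrite -[X in measurable X]setTI; exact: mf.
Qed.

Section initialization.
Context dT (T : measurableType dT) (R : realType) (P : probability T R).
Variables (m d : nat) (U : 'I_m -> 'I_d -> {RV P >-> R}) (A : 'I_m -> {RV P >-> R}).
Hypothesis indUA : mutually_independent P (init_family U A).
Hypothesis lawU : forall r k B, measurable B -> P (U r k @^-1` B) = normal_prob 0 1 B.
Hypothesis lawA : forall r, P (A r @^-1` [set 1]) = (1/2)%:E /\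
  P (A r @^-1` [set -1]) = (1/2)%:E.

Let X : ('I_m * 'I_d + 'I_m)%type -> T -> R := init_family U A.
Let mX i : measurable_fun setT (X i).
Proof. by case: i => [[r k]|r] /=; exact: measurable_funP. Qed.

(** The block of coordinates of one neuron: its weights and its output sign. *)
Definition neuron (r : 'I_m) (i : ('I_m * 'I_d + 'I_m)%type) : bool :=
  match i with inl rk => rk.1 == r | inr r' => r' == r end.

Lemma neuron_disj r r' i : neuron r i -> neuron r' i -> r = r'.
Proof. by case: i => [[r1 k]|r1] /= /eqP <- /eqP. Qed.

(** * Preactivations: exponential moments and mass near zero *)

Definition preact (v : 'I_d -> R) (r : 'I_m) (w : T) : R := dotv (fun k => U r k w) v.

Lemma preactN v r w : preact (fun k => - v k) r w = - preact v r w.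
Proof. by rewrite /preact /dotv -sumrN; apply: eq_bigr => k _; rewrite mulrN. Qed.

Lemma mfun_on_sum (K : Type) (s : seq K) (J : ('I_m * 'I_d + 'I_m)%type -> bool)
    (F : K -> T -> R) : (forall k, mfun_on X J (F k)) ->
  mfun_on X J (fun w => \sum_(k <- s) F k w).
Proof. by move=> mF; apply: measurable_sum => k; exact: mF. Qed.

Lemma preact_mfun_on v r (J : ('I_m * 'I_d + 'I_m)%type -> bool) :
  (forall k, J (inl (r, k))) -> mfun_on X J (preact v r).
Proof.
move=> Jr; apply: mfun_on_sum => k; apply: measurable_funM => //.
exact: (mfun_on_coord (X := X) (i := inl (r, k))).
Qed.

Lemma measurable_preact v r : measurable_fun setT (preact v r).
Proof. by apply: (mfun_onT mX (J := fun=> true)); exact: preact_mfun_on. Qed.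

Lemma lawU_integral r k (f : R -> \bar R) : measurable_fun setT f ->
  (forall t, 0 <= f t)%E ->
  (\int[P]_w f (U r k w) = \int[normal_prob 0 1]_t f t)%E.
Proof.
move=> mf f0.
have lw B : measurable B -> P (X (inl (r, k)) @^-1` B) = normal_prob 0 1 B.
  by move=> mB; exact: lawU.
exact: (law_integral (nu := normal_prob 0 1) (mX (inl (r, k))) lw mf f0).
Qed.

(** The exponential factors over independent weights, and the exponents add up to
    [s ^+ 2 * dotv v v / 2]. Such moments replace any identification of the law of a
    preactivation. *)
Lemma preact_mgf v r (s : R) : dotv v v = 1 ->
  (\int[P]_w (expR (s * preact v r w))%:E = (expR (s ^+ 2 / 2))%:E)%E.
Proof.
move=> v1.
transitivity (\int[P]_w (\prod_k expR (s * v k * U r k w))%:E)%E.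
  apply: eq_integral => w _; congr EFin; rewrite -expR_sum; congr expR.
  by rewrite /preact /dotv mulr_sumr; apply: eq_bigr => k _; ring.
rewrite (expectation_prod mX indUA (J := fun k => pred1 (inl (r, k)))); last 3 first.
- by move=> k k' i /= /eqP -> /eqP [].
- move=> k; apply: (measurableT_comp (@measurable_expR R)).
  apply: measurable_funM => //.
  exact: (mfun_on_coord (X := X) (J := pred1 (inl (r, k))) (i := inl (r, k)) (eqxx _)).
- by move=> k w; exact: expR_ge0.
transitivity (\prod_k (expR ((s * v k) ^+ 2 / 2))%:E)%E.
  apply: eq_bigr => k _.
  rewrite (lawU_integral _ _ (f := fun t => (expR (s * v k * t))%:E)).
  - exact: normal_mgf.
  - by apply/measurable_EFinP; apply: measurableT_comp => //; exact: measurable_funM.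
  - by move=> t; rewrite lee_fin expR_ge0.
rewrite prodEFin -expR_sum -mulr_suml; congr (expR (_ / 2))%:E.
rewrite -[RHS]mulr1 -v1 /dotv mulr_sumr; apply: eq_bigr => k _; ring.
Qed.

(** The weights are integrated out one at a time, each adding [v k ^+ 2] to the variance [V]; hence
    [V] must be arbitrary in the induction. *)
Lemma preact_gauss_seq v r (s : seq 'I_d) (V : R) : uniq s -> 0 < V ->
  (\int[P]_w (expR (- (\sum_(k <- s) U r k w * v k) ^+ 2 / (2 * V)))%:E =
   (Num.sqrt (V / (V + \sum_(k <- s) v k ^+ 2)))%:E)%E.
Proof.
elim: s V => [|k s IH] V.
  move=> _ V0; rewrite big_nil addr0 divff ?gt_eqF// sqrtr1.
  rewrite (eq_integral (cst 1%E)); last first.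
    by move=> w _; rewrite big_nil expr0n oppr0 mul0r expR0.
  by rewrite integral_cst// mul1e; exact: probability_setT.
move=> /= /andP[ks us] V0; rewrite big_cons.
have Vb : 0 < V + v k ^+ 2 by rewrite ltr_wpDr// sqr_ge0.
pose Z w := \sum_(j <- s) U r j w * v j.
have mZ : mfun_on X (fun i => if i is inl rk then rk.2 \in s else false) Z.
  have -> : Z = fun w => \sum_(j <- s) (if j \in s then U r j w * v j else 0).
    by apply/funext => w; rewrite /Z big_seq [RHS]big_seq; apply: eq_bigr => j ->.
  apply: mfun_on_sum => j; case: (boolP (j \in s)) => js; last exact: measurable_cst.
  apply: measurable_funM => //.
  by apply: (mfun_on_coord (X := X) (i := inl (r, j))).
have mU : mfun_on X (pred1 (inl (r, k))) (U r k).
  exact: (mfun_on_coord (X := X) (J := pred1 (inl (r, k))) (i := inl (r, k)) (eqxx _)).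
pose G (z : R * R) := (expR (- (z.1 + v k * z.2) ^+ 2 / (2 * V)))%:E.
have mG : measurable_fun setT G.
  apply/measurable_EFinP; apply: measurableT_comp => //.
  apply: measurable_funM => //; apply: measurableT_comp => //.
  apply: measurable_funX; apply: measurable_funD; first exact: measurable_fst.
  by apply: measurable_funM => //; exact: measurable_snd.
have G0 z : (0 <= G z)%E by rewrite lee_fin expR_ge0.
have disj i : (if i is inl rk then rk.2 \in s else false) ->
    pred1 (inl (r, k) : ('I_m * 'I_d + 'I_m)%type) i -> False.
  by move=> h /eqP e; move: h; rewrite e /= (negPf ks).
have := pair_integral (P := P) (mfun_onT mX mZ) (mfun_onT mX mU) mG G0
  (mfun_on_indep mX indUA disj mZ mU).
have inner w : (\int[P]_w' G (Z w, U r k w') = (Num.sqrt (V / (V + v k ^+ 2)) *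
    expR (- Z w ^+ 2 / (2 * (V + v k ^+ 2))))%:E)%E.
  rewrite (lawU_integral _ _ (f := fun t => G (Z w, t))).
  - exact: normal_gauss_conv.
  - exact: measurableT_comp.
  - by move=> t; exact: G0.
move=> E; transitivity (\int[P]_w G (Z w, U r k w))%E.
  by apply: eq_integral => w _; rewrite /G/= big_cons addrC [v k * _]mulrC.
rewrite E (eq_integral _ _ (fun w _ => inner w)).
under eq_integral do rewrite EFinM.
have mE : measurable_fun setT (fun w => (expR (- Z w ^+ 2 / (2 * (V + v k ^+ 2))))%:E).
  apply/measurable_EFinP; apply: measurableT_comp => //.
  apply: measurable_funM => //; apply: measurableT_comp => //.
  by apply: measurable_funX; exact: (mfun_onT mX mZ).
have c0 : (0 <= (Num.sqrt (V / (V + v k ^+ 2)))%:E)%E by rewrite lee_fin sqrtr_ge0.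
have E0 w : (0 <= (expR (- Z w ^+ 2 / (2 * (V + v k ^+ 2))))%:E)%E by rewrite lee_fin expR_ge0.
rewrite (ge0_integralZl P measurableT mE (fun w _ => E0 w) c0).
rewrite (IH (V + v k ^+ 2) us Vb) -EFinM; congr EFin.
rewrite -sqrtrM; last by rewrite divr_ge0// ltW.
rewrite addrA; congr Num.sqrt.
have S0 : 0 <= \sum_(j <- s) v j ^+ 2 by apply: sumr_ge0 => j _; exact: sqr_ge0.
by field; rewrite !gt_eqF// ltr_wpDr.
Qed.

Lemma expR_half_le2 : expR (1 / 2) <= 2 :> R.
Proof.
have h : 1 / 2 <= expR (- (1 / 2)) :> R.
  by apply: le_trans (expR_ge1Dx _); lra.
have : expR (1 / 2) * expR (- (1 / 2)) = 1 :> R by rewrite -expRD subrr expR0.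
have := expR_gt0 (1 / 2 : R); nra.
Qed.

Lemma probability_le_integral (B : set T) (W : T -> R) : measurable B ->
  measurable_fun setT W -> (forall w, 0 <= W w) -> (forall w, B w -> 1 <= W w) ->
  (P B <= \int[P]_w (W w)%:E)%E.
Proof.
move=> mB mW W0 W1; rewrite -[X in (P X <= _)%E](setIT B) -integral_indic//.
apply: ge0_le_integral => //.
- by apply/measurable_EFinP; exact: measurable_indic.
- exact/measurable_EFinP.
- move=> w _; rewrite lee_fin indicE; have [/set_mem/W1//|_] := boolP (w \in B).
  exact: W0.
Qed.

(** A Gaussian kernel of width [D], scaled by [expR (1 / 2)], dominates the indicator of the window.
    Its integral is [expR (1 / 2) * sqrt (D ^+ 2 / (D ^+ 2 + 1))], at most [2 * D]. *)
Lemma preact_small v r (D : R) : dotv v v = 1 -> 0 < D ->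
  (P [set w | (`|preact v r w| <= D)%R] <= (2 * D)%:E)%E.
Proof.
move=> v1 D0.
pose W w := expR (1 / 2) * expR (- (preact v r w) ^+ 2 / (2 * D ^+ 2)).
have mE : measurable_fun setT (fun w => expR (- (preact v r w) ^+ 2 / (2 * D ^+ 2))).
  apply: measurableT_comp => //; apply: measurable_funM => //.
  by apply: measurableT_comp => //; apply: measurable_funX; exact: measurable_preact.
have mS : measurable [set w | `|preact v r w| <= D].
  rewrite -[X in measurable X]setTI.
  have -> : [set w | `|preact v r w| <= D] = (fun w => `|preact v r w|) @^-1` `]-oo, D].
    by apply/seteqP; split => w /=; rewrite in_itv.
  by apply: (measurableT_comp (@normr_measurable R setT) (measurable_preact v r)).
apply: (le_trans (probability_le_integral (W := W) mS _ _ _)).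
- exact: measurable_funM.
- by move=> w; rewrite mulr_ge0 ?expR_ge0.
- move=> w /= zD; rewrite /W -expRD -[leLHS]expR0 ler_expR.
  have : preact v r w ^+ 2 / (2 * D ^+ 2) <= 1 / 2.
    rewrite ler_pdivrMr ?mulr_gt0 ?exprn_gt0//.
    have -> : 1 / 2 * (2 * D ^+ 2) = D ^+ 2 by field.
    by rewrite -real_normK ?num_real// ler_pXn2r ?nnegrE// ltW.
  by rewrite mulNr; lra.
rewrite /W; under eq_integral do rewrite EFinM.
have mE' : measurable_fun setT (fun w => (expR (- preact v r w ^+ 2 / (2 * D ^+ 2)))%:E).
  exact/measurable_EFinP.
have c0 : (0 <= (expR (1 / 2 : R))%:E)%E by rewrite lee_fin expR_ge0.
have E0 w : (0 <= (expR (- preact v r w ^+ 2 / (2 * D ^+ 2)))%:E)%E by rewrite lee_fin expR_ge0.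
rewrite (ge0_integralZl P measurableT mE' (fun w _ => E0 w) c0).
rewrite (preact_gauss_seq _ _ (index_enum_uniq _)) ?exprn_gt0//.
have -> : \sum_k v k ^+ 2 = 1 by rewrite -v1; apply: eq_bigr => k _; rewrite expr2.
rewrite -EFinM lee_fin; apply: ler_pM; [exact: expR_ge0|exact: sqrtr_ge0|exact: expR_half_le2|].
rewrite -(@ler_pXn2r _ 2) ?nnegrE ?sqrtr_ge0 ?(ltW D0)//.
have D2 : 0 < D ^+ 2 by rewrite exprn_gt0.
rewrite sqr_sqrtr; last by rewrite divr_ge0//; lra.
by rewrite ler_pdivrMr; [nra|lra].
Qed.

Lemma measurable_forall (K : finType) (F : K -> set T) :
  (forall k, measurable (F k)) -> measurable [set w | forall k, F k w].
Proof.
move=> mF; have -> : [set w | forall k, F k w] = \bigcap_(k in [set: K]) F k.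
  by apply/seteqP; split => w /= h k; [move=> _; exact: h|exact: h].
by apply: fin_bigcap_measurable => // k _; exact: mF.
Qed.

Lemma union_bound (K : finType) (F : K -> set T) (b : K -> R) :
  (forall k, measurable (F k)) -> (forall k, (P (F k) <= (b k)%:E)%E) ->
  measurable [set w | exists k, F k w] /\
  (P [set w | exists k, F k w] <= (\sum_k b k)%:E)%E.
Proof.
move=> mF Fb.
have main (s : seq K) : measurable [set w | exists2 k, k \in s & F k w] /\
    (P [set w | exists2 k, k \in s & F k w] <= (\sum_(k <- s) b k)%:E)%E.
  elim: s => [|k s [IH1 IH2]].
    have -> : [set w | exists2 k, k \in [::] & F k w] = set0.
      by apply/seteqP; split => w //= [].
    by rewrite measure0 big_nil; split.
  have -> : [set w | exists2 k', k' \in k :: s & F k' w] =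
      F k `|` [set w | exists2 k, k \in s & F k w].
    apply/seteqP; split => w /=.
      by move=> [k']; rewrite inE => /orP[/eqP ->|k's] Fw; [left|right; exists k'].
    move=> [Fw|[k' k's Fw]]; first by exists k => //; rewrite inE eqxx.
    by exists k' => //; rewrite inE k's orbT.
  split; first exact: measurableU.
  apply: (le_trans (measureU2 P (mF k) IH1)).
  by rewrite big_cons EFinD; apply: leeD; [exact: Fb|exact: IH2].
have [m1 m2] := main (index_enum K).
have E : [set w | exists k, F k w] = [set w | exists2 k, k \in index_enum K & F k w].
  apply/seteqP; split => w /= [k]; first by exists k => //; exact: mem_index_enum.
  by exists k.
by rewrite E.
Qed.

(** The law of [A] is given by its two atoms, so values outside -1 and 1 are excluded only almost
    surely; the pathwise arguments are made on this event. *)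
Definition signs : set T := [set w | forall r, A r w = 1 \/ A r w = -1].

Lemma measurable_signs : measurable signs.
Proof.
apply: measurable_forall => r.
apply: (@measurableU _ _ (A r @^-1` [set 1]) (A r @^-1` [set -1]));
  by rewrite -[X in measurable X]setTI; exact: (mX (inr r)).
Qed.

Lemma signs_prob : (P (~` signs) <= 0)%E.
Proof.
pose F r := ~` (A r @^-1` [set 1] `|` A r @^-1` [set -1]).
have mA1 r (t : R) : measurable (A r @^-1` [set t]).
  by rewrite -[X in measurable X]setTI; exact: (mX (inr r)).
have mF r : measurable (F r) by apply: measurableC; exact: measurableU.
have Fb r : (P (F r) <= 0%:E)%E.
  have [h1 h2] := lawA r.
  have h : P (A r @^-1` [set 1] `|` A r @^-1` [set -1]) = 1%:E :> \bar R.
    transitivity (P (A r @^-1` [set 1%R]) + P (A r @^-1` [set (-1)%R]))%E.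
      apply: measureU => //; apply/seteqP; split => w //= [-> /eqP].
      by rewrite -addr_eq0 => /eqP; lra.
    by rewrite h1 h2 -EFinD; congr EFin; field.
  by rewrite probability_setC ?h ?subee//; exact: measurableU.
have [_] := union_bound mF Fb; rewrite big1//; apply: le_trans.
apply: le_measure; rewrite ?inE.
- by apply: measurableC; exact: measurable_signs.
- by have [] := union_bound mF Fb.
- move=> w /existsNP[r] /not_orP [h1 h2]; exists r.
  by move=> [].
Qed.

(** * Subgaussian tail of the initial outputs *)

Definition netw v w : R := net (fun r => A r w) (fun r k => U r k w) v.

Lemma measurable_relu : measurable_fun setT (@relu R).
Proof. exact: measurable_maxr. Qed.

Lemma measurable_netw v : measurable_fun setT (netw v).
Proof.
apply: measurable_funM => //; apply: measurable_sum => r; apply: measurable_funM.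
  exact: (mX (inr r)).
by apply: measurableT_comp; [exact: measurable_relu|exact: measurable_preact].
Qed.

(** For positive [z] the sides agree; otherwise the left side is 2, the least value of twice a
    [cosh]. *)
Lemma expR_relu_sum (t z : R) :
  expR (t * relu z) + expR (- t * relu z) <= expR (t * z) + expR (- t * z).
Proof.
rewrite /relu; have [z0|z0] := leP z 0; last by [].
rewrite !mulr0 expR0.
have e1 : expR (t * z) = expR (t * z / 2) ^+ 2.
  by rewrite -expRM_natl; congr expR; field.
have e2 : expR (- t * z) = expR (- (t * z / 2)) ^+ 2.
  by rewrite -expRM_natl; congr expR; field.
have e3 : expR (t * z / 2) * expR (- (t * z / 2)) = 1 by rewrite -expRD subrr expR0.
have := sqr_ge0 (expR (t * z / 2) - expR (- (t * z / 2))).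
rewrite e1 e2; nra.
Qed.

Lemma integral_indicP (B : set T) : measurable B ->
  (\int[P]_w (\1_B w)%:E = P B)%E.
Proof. by move=> mB; rewrite integral_indic// setIT. Qed.

(** On [signs] the integrand is the exponential of [t] times the signed ReLU. Written with
    indicators, it is a sum of products of independent factors; averaging the sign gives a [cosh],
    where the ReLU may be replaced by its argument. *)
Lemma sign_relu_mgf v r (t : R) : dotv v v = 1 ->
  (\int[P]_w (\1_[set 1] (A r w) * expR (t * relu (preact v r w)) +
     \1_[set -1] (A r w) * expR (- t * relu (preact v r w)))%:E <=
   (expR (t ^+ 2 / 2))%:E)%E.
Proof.
move=> v1.
pose g (b : R) w := expR (b * relu (preact v r w)).
pose s (b : R) w : R := \1_[set b] (A r w).
have mgJ b : mfun_on X (fun i => if i is inl rk then rk.1 == r else false) (g b).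
  apply: (measurableT_comp (@measurable_expR R)); apply: measurable_funM => //.
  apply: (measurableT_comp measurable_relu).
  by apply: preact_mfun_on => k /=.
have msJ b : mfun_on X (pred1 (inr r)) (s b).
  have mi : measurable_fun setT (\1_[set b] : R -> R) by exact: measurable_indic.
  apply: (measurableT_comp mi).
  exact: (mfun_on_coord (X := X) (J := pred1 (inr r)) (i := inr r) (eqxx _)).
have mg b := mfun_onT mX (mgJ b).
have ms b := mfun_onT mX (msJ b).
have g0 b w : 0 <= g b w by exact: expR_ge0.
have s0 b w : 0 <= s b w by rewrite /s indicE.
have disj i : pred1 (inr r : ('I_m * 'I_d + 'I_m)%type) i ->
    (if i is inl rk then rk.1 == r else false) -> False.
  by move=> /eqP ->.
have half b : b = 1 \/ b = -1 -> (\int[P]_w (s b w)%:E = (1/2)%:E)%E.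
  move=> bE; transitivity (P (A r @^-1` [set b])).
    rewrite -integral_indicP; last first.
      by rewrite -[X in measurable X]setTI; exact: (mX (inr r)).
    by apply: eq_integral => w _; rewrite /s !indicE.
  by have [h1 h2] := lawA r; case: bE => ->.
have prodE b c : b = 1 \/ b = -1 ->
    (\int[P]_w (s b w * g c w)%:E = (1/2)%:E * \int[P]_w (g c w)%:E)%E.
  move=> bE; rewrite (expectation_mul_indep mX indUA disj (msJ b) (mgJ c))// half//.
have sg0 b c w : (0 <= (s b w * g c w)%:E)%E by rewrite lee_fin mulr_ge0.
have msg b c : measurable_fun setT (fun w => (s b w * g c w)%:E).
  by apply/measurable_EFinP; exact: measurable_funM.
have mgE c : measurable_fun setT (fun w => (g c w)%:E) by exact/measurable_EFinP.
have gE0 c w : (0 <= (g c w)%:E)%E by rewrite lee_fin.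
rewrite (_ : (fun _ => _) = fun w => ((s 1 w * g t w)%:E + (s (-1) w * g (- t) w)%:E)%E)//.
rewrite (ge0_integralD P measurableT (fun w _ => sg0 1 t w) (msg 1 t)
  (fun w _ => sg0 (-1) (- t) w) (msg (-1) (- t))).
rewrite !prodE; [|by right|by left].
rewrite -ge0_muleDr; [|by apply: integral_ge0 => w _; exact: gE0..].
rewrite -(ge0_integralD P measurableT (fun w _ => gE0 t w) (mgE t)
  (fun w _ => gE0 (- t) w) (mgE (- t))).
pose e (b : R) w := expR (b * preact v r w).
have meE b : measurable_fun setT (fun w => (e b w)%:E).
  apply/measurable_EFinP; apply: measurableT_comp => //; apply: measurable_funM => //.
  exact: measurable_preact.
have eE0 b w : (0 <= (e b w)%:E)%E by rewrite lee_fin expR_ge0.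
have le1 : (\int[P]_w ((g t w)%:E + (g (- t) w)%:E) <=
    \int[P]_w ((e t w)%:E + (e (- t) w)%:E))%E.
  apply: ge0_le_integral => //.
  - by move=> w _; rewrite adde_ge0.
  - exact: emeasurable_funD.
  - exact: emeasurable_funD.
  - by move=> w _; rewrite -!EFinD lee_fin; exact: expR_relu_sum.
apply: (le_trans (lee_wpmul2l _ le1)); first by rewrite lee_fin; lra.
rewrite (ge0_integralD P measurableT (fun w _ => eE0 t w) (meE t)
  (fun w _ => eE0 (- t) w) (meE (- t))).
rewrite /e !preact_mgf// sqrrN -EFinD -EFinM lee_fin; lra.
Qed.

Lemma lee_prod_cst (K : finType) (F : K -> \bar R) (b : R) :
  (forall k, (0 <= F k <= b%:E)%E) -> (\prod_k F k <= (b ^+ #|K|)%:E)%E.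
Proof.
move=> Fb.
have main (s : seq K) : (0 <= \prod_(k <- s) F k <= (b ^+ size s)%:E)%E.
  elim: s => [|k s /andP[IH1 IH2]]; first by rewrite big_nil expr0 lee_fin ler01 lexx.
  rewrite big_cons exprS EFinM; have /andP[h1 h2] := Fb k.
  by rewrite mule_ge0//= lee_pmul.
by have /andP[_] := main (index_enum K); rewrite cardT enumT.
Qed.

(** Chernoff bound: the [m] independent neurons, each with parameter [s / sqrt m], contribute
    [s ^+ 2 / 2] to the exponent altogether. On [signs] the product of the [W r] is exactly the
    exponential of [s] times the output. *)
Lemma net_tail v (s b : R) : (0 < m)%N -> dotv v v = 1 ->
  (P (signs `&` [set w | (b <= s * netw v w)%R]) <= (expR (s ^+ 2 / 2 - b))%:E)%E.
Proof.
move=> m0 v1; pose c := s / Num.sqrt m%:R.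
pose W r w := \1_[set 1] (A r w) * expR (c * relu (preact v r w)) +
     \1_[set -1] (A r w) * expR (- c * relu (preact v r w)).
have W0 r w : 0 <= W r w by rewrite addr_ge0// mulr_ge0 ?expR_ge0// indicE.
have mind (b' : R) : measurable_fun setT (\1_[set b'] : R -> R).
  by apply: measurable_indic.
have mW r : mfun_on X (neuron r) (W r).
  have mA : mfun_on X (neuron r) (A r).
    exact: (mfun_on_coord (X := X) (J := neuron r) (i := inr r) (eqxx _)).
  have mp : mfun_on X (neuron r) (preact v r).
    by apply: preact_mfun_on => k; exact: eqxx.
  have me (c' : R) : mfun_on X (neuron r) (fun w => expR (c' * relu (preact v r w))).
    apply: (measurableT_comp (@measurable_expR R)); apply: measurable_funM => //.
    exact: (measurableT_comp measurable_relu mp).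
  have ms (b' : R) : mfun_on X (neuron r) (fun w => \1_[set b'] (A r w)).
    exact: (measurableT_comp (mind b') mA).
  by apply: measurable_funD; apply: measurable_funM;
    [exact: ms|exact: me|exact: ms|exact: me].
have mW' r := mfun_onT mX (mW r).
have mB : measurable (signs `&` [set w | b <= s * netw v w]).
  apply: measurableI; first exact: measurable_signs.
  by apply: measurable_ge; apply: measurable_funM => //; exact: measurable_netw.
apply: (le_trans (probability_le_integral (W := fun w => expR (- b) * \prod_r W r w) mB _ _ _)).
- by apply: measurable_funM => //; apply: measurable_prod => r _; exact: mW'.
- by move=> w; rewrite mulr_ge0 ?expR_ge0// prodr_ge0.
- move=> w [/= sw bw].
  have -> : \prod_r W r w = expR (s * netw v w).
    rewrite /netw /net mulrA mulr_sumr expR_sum; apply: eq_bigr => r _.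
    rewrite /W /c -/(preact v r w) !indicE; have [->|->] := sw r.
      rewrite mem_set// memNset; last by move=> /= /eqP; rewrite -addr_eq0 => /eqP; lra.
      by rewrite mul1r mul0r addr0 mul1r; congr expR; ring.
    rewrite memNset; last by move=> /= /eqP; rewrite eq_sym -addr_eq0 => /eqP; lra.
    by rewrite mem_set// mul0r mul1r add0r; congr expR; ring.
  by rewrite -expRD -[leLHS]expR0 ler_expR; lra.
have mPE : measurable_fun setT (fun w => (\prod_r W r w)%:E).
  by apply/measurable_EFinP; apply: measurable_prod => r _; exact: mW'.
have PE0 w : (0 <= (\prod_r W r w)%:E)%E by rewrite lee_fin prodr_ge0.
have c0 : (0 <= (expR (- b))%:E)%E by rewrite lee_fin expR_ge0.
under eq_integral do rewrite EFinM.
rewrite (ge0_integralZl P measurableT mPE (fun w _ => PE0 w) c0).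
rewrite (expectation_prod mX indUA (J := neuron))//; last exact: neuron_disj.
apply: (@le_trans _ _ ((expR (- b))%:E * (expR (c ^+ 2 / 2) ^+ #|'I_m|)%:E)%E).
  apply: lee_wpmul2l => //; apply: lee_prod_cst => r.
  apply/andP; split; last exact: sign_relu_mgf.
  by apply: integral_ge0 => w _; rewrite lee_fin.
rewrite -EFinM lee_fin card_ord -expRM_natl -expRD ler_expR.
have -> : m%:R * (c ^+ 2 / 2) = s ^+ 2 / 2.
  rewrite /c exprMn exprVn sqr_sqrtr ?ler0n//; field.
  by rewrite gt_eqF// ltr0n.
lra.
Qed.

(** * Number of neurons near a boundary *)

Definition flip_count v (D : R) (w : T) : R :=
  \sum_r (if `|preact v r w| <= D then 1 else 0).

Lemma measurable_flip_ind (D : R) :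
  measurable_fun setT (fun t : R => if `|t| <= D then 1 else 0 : R).
Proof.
have mN : measurable [set t : R | `|t| <= D].
  have -> : [set t : R | `|t| <= D] = (fun t => `|t|) @^-1` `]-oo, D].
    by apply/seteqP; split => w /=; rewrite in_itv.
  by rewrite -[X in measurable X]setTI; exact: (@normr_measurable R setT).
have -> : (fun t : R => if `|t| <= D then 1 else 0 : R) = \1_[set t | `|t| <= D].
  apply/funext => t; rewrite indicE; case: ifPn => h; first by rewrite mem_set.
  by rewrite memNset//; exact/negP.
exact: measurable_indic.
Qed.

Lemma measurable_flip_count v D : measurable_fun setT (flip_count v D).
Proof.
apply: measurable_sum => r; apply: (measurableT_comp (measurable_flip_ind D)).
exact: measurable_preact.
Qed.

(** Chernoff bound with parameter 1/2: for an indicator [F], [expR (F / 2) <= 1 + F], whose mean is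
    at most [1 + 2 * D <= expR (2 * D)]. *)
Lemma flip_tail v (D b : R) : dotv v v = 1 -> 0 < D ->
  (P [set w | (b <= flip_count v D w)%R] <= (expR (2 * D * m%:R - b / 2))%:E)%E.
Proof.
move=> v1 D0.
pose F (t : R) : R := if `|t| <= D then 1 else 0.
pose W r w := 1 + F (preact v r w).
have F01 t : 0 <= F t <= 1 by rewrite /F; case: ifP; rewrite ?lexx ?ler01.
have W0 r w : 0 <= W r w by have /andP[] := F01 (preact v r w); rewrite /W; lra.
have mF r : mfun_on X (neuron r) (fun w => F (preact v r w)).
  apply: (measurableT_comp (measurable_flip_ind D)).
  by apply: preact_mfun_on => k; exact: eqxx.
have mW r : mfun_on X (neuron r) (W r) by apply: measurable_funD => //; exact: mF.
have mW' r := mfun_onT mX (mW r).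
have mB : measurable [set w | b <= flip_count v D w].
  by apply: measurable_ge; exact: measurable_flip_count.
apply: (le_trans (probability_le_integral
  (W := fun w => expR (- (b / 2)) * \prod_r W r w) mB _ _ _)).
- by apply: measurable_funM => //; apply: measurable_prod => r _; exact: mW'.
- by move=> w; rewrite mulr_ge0 ?expR_ge0// prodr_ge0.
- move=> w /= bw.
  apply: (@le_trans _ _ (expR (- (b / 2)) * expR (flip_count v D w / 2))).
    by rewrite -expRD -[leLHS]expR0 ler_expR; lra.
  apply: ler_wpM2l; first exact: expR_ge0.
  rewrite /flip_count mulr_suml expR_sum; apply: ler_prod => r _.
  rewrite expR_ge0/= /W /F; case: ifP => _; first by have := expR_half_le2; lra.
  by rewrite mul0r expR0 addr0.
have mPE : measurable_fun setT (fun w => (\prod_r W r w)%:E).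
  by apply/measurable_EFinP; apply: measurable_prod => r _; exact: mW'.
have PE0 w : (0 <= (\prod_r W r w)%:E)%E by rewrite lee_fin prodr_ge0.
have c0 : (0 <= (expR (- (b / 2)))%:E)%E by rewrite lee_fin expR_ge0.
under eq_integral do rewrite EFinM.
rewrite (ge0_integralZl P measurableT mPE (fun w _ => PE0 w) c0).
rewrite (expectation_prod mX indUA (J := neuron))//; last exact: neuron_disj.
apply: (@le_trans _ _ ((expR (- (b / 2)))%:E * (expR (2 * D) ^+ #|'I_m|)%:E)%E).
  apply: lee_wpmul2l => //; apply: lee_prod_cst => r.
  rewrite integral_ge0//=; last by move=> w _; rewrite lee_fin.
  have mS : measurable [set w | `|preact v r w| <= D].
    have -> : [set w | `|preact v r w| <= D] = (fun w => `|preact v r w|) @^-1` `]-oo, D].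
      by apply/seteqP; split => w /=; rewrite in_itv.
    rewrite -[X in measurable X]setTI.
    by apply: (measurableT_comp (@normr_measurable R setT) (measurable_preact v r)).
  have mFE : measurable_fun setT (fun w => (F (preact v r w))%:E).
    by apply/measurable_EFinP; exact: (mfun_onT mX (mF r)).
  have FE0 w : (0 <= (F (preact v r w))%:E)%E.
    by rewrite lee_fin; have /andP[] := F01 (preact v r w).
  rewrite (eq_integral (fun w => (1%E + (F (preact v r w))%:E)%E))//.
  rewrite (ge0_integralD P measurableT (fun _ _ => lee01) (measurable_cst _)
    (fun w _ => FE0 w) mFE) integral_cst// mul1e.
  have -> : (\int[P]_w (F (preact v r w))%:E = P [set w | (`|preact v r w| <= D)%R])%E.
    rewrite -integral_indicP//; apply: eq_integral => w _; congr EFin.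
    rewrite indicE /F; case: ifPn => h; first by rewrite mem_set.
    by rewrite memNset//; exact/negP.
  have PT : P [set: T] = 1%E by exact: probability_setT.
  apply: (@le_trans _ _ (1%:E + (2 * D)%:E)%E).
    by apply: leeD; [rewrite -PT|exact: preact_small].
  by rewrite -EFinD lee_fin expR_ge1Dx.
rewrite -EFinM lee_fin card_ord -expRM_natl -expRD ler_expR; lra.
Qed.

(** * Probabilities of inactive and of active neurons *)

Lemma amgm_half (t M : R) : 0 < M -> t <= M / 2 + 1 / (2 * M) * t ^+ 2.
Proof.
move=> M0; have -> : M / 2 + 1 / (2 * M) * t ^+ 2 = (M ^+ 2 + t ^+ 2) / (2 * M).
  by field; rewrite gt_eqF.
by rewrite ler_pdivlMr ?mulr_gt0//; have := sqr_ge0 (M - t); nra.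
Qed.

(** An explicit positive lower bound for the probability that a standard Gaussian is negative, built
    from the first two moments of [exp (- z)]. Only its positivity and being at most 1 matter
    later. *)
Definition neg_prob_lb : R := (expR (1 / 2) - 1) ^+ 2 / expR 2.

Lemma neg_prob_lb_gt0 : 0 < neg_prob_lb.
Proof.
apply: divr_gt0; last exact: expR_gt0.
apply: exprn_gt0; have := expR_ge1Dx (1 / 2 : R); lra.
Qed.

(* Integrate [exp (- z) <= 1 + M / 2 * [z < 0] + exp (- 2 z) / (2 M)], an instance of
   [amgm_half] where [z < 0]; [M] is the optimal choice. *)
Lemma preact_neg v r : dotv v v = 1 -> (neg_prob_lb%:E <= P [set w | (preact v r w < 0)%R])%E.
Proof.
move=> v1.
pose a : R := expR (1 / 2); pose b : R := expR 2; pose M := b / (a - 1).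
have a1 : 1 < a by rewrite /a; have := expR_ge1Dx (1 / 2 : R); lra.
have b0 : 0 < b by exact: expR_gt0.
have M0 : 0 < M by rewrite divr_gt0//; lra.
pose B := [set w | preact v r w < 0].
have mB : measurable B by apply: measurable_lt; exact: measurable_preact.
have [p pE] : exists p : R, P B = p%:E.
  by exists (fine (P B)); rewrite fineK// fin_num_measure.
have mEx (s : R) : measurable_fun setT (fun w => (expR (s * preact v r w))%:E).
  apply/measurable_EFinP; apply: measurableT_comp => //; apply: measurable_funM => //.
  exact: measurable_preact.
have Ex0 (s : R) w : (0 <= (expR (s * preact v r w))%:E)%E by rewrite lee_fin expR_ge0.
have mI : measurable_fun setT (fun w => (\1_B w : R)%:E).
  by apply/measurable_EFinP; exact: measurable_indic.
have I0 w : (0 <= (\1_B w : R)%:E)%E by rewrite lee_fin indicE.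
have Mc0 : (0 <= (M / 2)%:E)%E by rewrite lee_fin; lra.
have Mi0 : (0 <= (1 / (2 * M))%:E)%E by rewrite lee_fin divr_ge0// mulr_ge0// ltW.
have : (\int[P]_w (expR (- 1 * preact v r w))%:E <=
  \int[P]_w (1%:E + ((M / 2)%:E * (\1_B w)%:E +
     (1 / (2 * M))%:E * (expR (- 2 * preact v r w))%:E)))%E.
  apply: ge0_le_integral => //.
  - by apply: emeasurable_funD => //; apply: emeasurable_funD; exact: measurable_funeM.
  - move=> w _; rewrite -!EFinM -!EFinD lee_fin.
    have -> : expR (- 2 * preact v r w) = expR (- 1 * preact v r w) ^+ 2.
      by rewrite -expRM_natl; congr expR; ring.
    set t := expR (- 1 * _).
    have t0 : 0 < t by exact: expR_gt0.
    have h0 : 0 <= 1 / (2 * M) * t ^+ 2 by rewrite mulr_ge0 ?sqr_ge0// divr_ge0// mulr_ge0// ltW.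
    rewrite indicE; have [wB|wB] := boolP (w \in B).
      have := amgm_half t M0.
      rewrite mulr1; lra.
    have : t <= 1.
      rewrite -[leRHS]expR0 ler_expR; move: wB; rewrite notin_setE /B /= => /negP.
      rewrite -leNgt; lra.
    rewrite mulr0; lra.
pose f1 w : \bar R := ((M / 2)%:E * (\1_B w)%:E)%E.
pose f2 w : \bar R := ((1 / (2 * M))%:E * (expR (- 2 * preact v r w))%:E)%E.
have m1 : measurable_fun setT f1 by exact: measurable_funeM.
have m2 : measurable_fun setT f2 by exact: measurable_funeM.
have f10 w : (0 <= f1 w)%E by rewrite mule_ge0.
have f20 w : (0 <= f2 w)%E by rewrite mule_ge0.
have m12 : measurable_fun setT (fun w => f1 w + f2 w)%E by exact: emeasurable_funD.
have f120 w : (0 <= f1 w + f2 w)%E by rewrite adde_ge0.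
rewrite (ge0_integralD P measurableT (fun _ _ => lee01) (measurable_cst _)
  (fun w _ => f120 w) m12).
rewrite (ge0_integralD P measurableT (fun w _ => f10 w) m1 (fun w _ => f20 w) m2).
rewrite (ge0_integralZl P measurableT mI (fun w _ => I0 w) Mc0).
rewrite (ge0_integralZl P measurableT (mEx (- 2)) (fun w _ => Ex0 (- 2) w) Mi0).
have int1 : (\int[P]_(w in [set: T]) 1%:E = 1%:E :> \bar R)%E.
  by rewrite integral_cst// mul1e; exact: probability_setT.
rewrite !preact_mgf// integral_indicP// pE int1.
rewrite -!EFinM -!EFinD lee_fin.
have -> : (- 1) ^+ 2 / 2 = 1 / 2 :> R by field.
have -> : (- 2) ^+ 2 / 2 = 2 :> R by field.
rewrite -/a -/b lee_fin => h.
have -> : neg_prob_lb = (a - 1) ^+ 2 / b by [].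
have e1 : 1 / (2 * M) * b = (a - 1) / 2 by rewrite /M; field; rewrite !gt_eqF//; lra.
have h2 : (a - 1) / 2 <= b / (a - 1) / 2 * p by rewrite e1 /M in h; lra.
have -> : p = (b / (a - 1) / 2 * p) * (2 * (a - 1) / b).
  by field; rewrite !gt_eqF//; lra.
have -> : (a - 1) ^+ 2 / b = (a - 1) / 2 * (2 * (a - 1) / b) by field; rewrite gt_eqF.
apply: ler_wpM2r => //; rewrite mulr_ge0 ?invr_ge0 ?(ltW b0)//; lra.
Qed.

(** Neurons are independent. With a single data point this event makes the Gram matrix vanish. *)
Lemma all_neg v : dotv v v = 1 ->
  ((neg_prob_lb ^+ m)%:E <= P [set w | forall r, (preact v r w < 0)%R])%E.
Proof.
move=> v1.
have mi : measurable_fun setT (\1_[set t : R | t < 0] : R -> R).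
  by apply: measurable_indic; apply: measurable_lt; exact: measurable_id.
pose W r w : R := \1_[set t : R | t < 0] (preact v r w).
have mW r : mfun_on X (neuron r) (W r).
  apply: (measurableT_comp mi).
  by apply: preact_mfun_on => k; exact: eqxx.
have W0 r w : 0 <= W r w by rewrite /W indicE.
have mB r : measurable [set w | preact v r w < 0].
  by apply: measurable_lt; exact: measurable_preact.
have := expectation_prod mX indUA (J := neuron) neuron_disj mW W0.
have -> : (\int[P]_w (\prod_r W r w)%:E = P [set w | forall r, (preact v r w < 0)%R])%E.
  rewrite -integral_indicP; last exact: measurable_forall.
  apply: eq_integral => w _; congr EFin; rewrite indicE.
  have [/set_mem h|/negP h] := boolP (w \in [set w | forall r, preact v r w < 0]).
    by rewrite big1// => r _; rewrite /W indicE mem_set//; exact: h.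
  have [r hr] : exists r, ~ (preact v r w < 0).
    by apply/existsNP => h'; apply: h; apply/mem_set.
  have W00 : W r w = 0 by rewrite /W indicE memNset.
    by rewrite (bigD1 r)//= W00 mul0r.
move=> ->.
have main (s : seq 'I_m) : ((neg_prob_lb ^+ size s)%:E <= \prod_(r <- s) \int[P]_w (W r w)%:E)%E.
  elim: s => [|r s IH]; first by rewrite big_nil expr0.
  rewrite big_cons exprS EFinM; apply: lee_pmul => //.
  - by rewrite lee_fin ltW// neg_prob_lb_gt0.
  - by rewrite lee_fin exprn_ge0// ltW// neg_prob_lb_gt0.
  - have -> : (\int[P]_w (W r w)%:E = P [set w | (preact v r w < 0)%R])%E.
      rewrite -integral_indicP//; by apply: eq_integral => w _; congr EFin; rewrite /W /indic.
    exact: preact_neg.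
have := main (index_enum 'I_m).
by have -> : size (index_enum 'I_m) = m by rewrite -[RHS]card_ord cardT enumT.
Qed.

Definition act_count v (w : T) : R := \sum_r (if 0 <= preact v r w then 1 else 0).

(** Reverse Markov inequality: the mean count is at least [neg_prob_lb * m], by the bound for
    negative preactivations applied to [- v], while the count never exceeds [m]. *)
Lemma act_count_many v : (0 < m)%N -> dotv v v = 1 ->
  measurable [set w | neg_prob_lb / 2 * m%:R <= act_count v w] /\
  ((neg_prob_lb / 2)%:E <= P [set w | (neg_prob_lb / 2 * m%:R <= act_count v w)%R])%E.
Proof.
move=> m0 v1; have mR : 0 < m%:R :> R by rewrite ltr0n.
pose f (t : R) : R := if 0 <= t then 1 else 0.
have mf : measurable_fun setT f.
  have -> : f = \1_[set t | 0 <= t].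
    apply/funext => t; rewrite indicE /f; case: ifPn => h; first by rewrite mem_set.
    by rewrite memNset//; exact/negP.
  by apply: measurable_indic; apply: measurable_ge; exact: measurable_id.
have mfp r : measurable_fun setT (fun w => f (preact v r w)).
  by apply: (measurableT_comp mf); exact: measurable_preact.
have f0 t : 0 <= f t by rewrite /f; case: ifP.
have mc : measurable_fun setT (act_count v) by apply: measurable_sum => r; exact: mfp.
pose B := [set w | neg_prob_lb / 2 * m%:R <= act_count v w].
have mB : measurable B by exact: measurable_ge.
split=> //.
have [p pE] : exists p : R, P B = p%:E.
  by exists (fine (P B)); rewrite fineK// fin_num_measure.
have h1 : ((neg_prob_lb * m%:R)%:E <= \int[P]_w (act_count v w)%:E)%E.
  have -> : (\int[P]_w (act_count v w)%:E = \sum_r \int[P]_w (f (preact v r w))%:E)%E.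
    rewrite -ge0_integral_sum//; last 2 first.
    - by move=> r; apply/measurable_EFinP; exact: mfp.
    - by move=> r w _; rewrite lee_fin.
    by apply: eq_integral => w _; rewrite sumEFin.
  have -> : (neg_prob_lb * m%:R)%:E = (\sum_(r < m) neg_prob_lb%:E)%E.
    by rewrite sumEFin sumr_const card_ord mulr_natr.
  apply: lee_sum => r _.
  have Nv1 : dotv (fun k => - v k) (fun k => - v k) = 1.
    by rewrite -v1; apply: eq_bigr => k _; rewrite mulrNN.
  apply: (le_trans (preact_neg r Nv1)).
  apply: probability_le_integral => //.
  - by apply: measurable_lt; exact: measurable_preact.
  - by move=> w /=; rewrite preactN oppr_lt0 => h; rewrite /f (ltW h) lexx.
have h2 : (\int[P]_w (act_count v w)%:E <=
    \int[P]_w (m%:R%:E * (\1_B w : R)%:E + (neg_prob_lb / 2 * m%:R)%:E))%E.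
  apply: ge0_le_integral => //.
  - by move=> w _; rewrite lee_fin; apply: sumr_ge0 => r _; case: ifP.
  - exact/measurable_EFinP.
  - apply: emeasurable_funD => //; apply: measurable_funeM.
    by apply/measurable_EFinP; exact: measurable_indic.
  - move=> w _; rewrite -EFinM -EFinD lee_fin indicE.
    have q00 := neg_prob_lb_gt0.
    have qm : 0 <= neg_prob_lb / 2 * m%:R by apply: mulr_ge0 => //; lra.
    have [wB|wB] := boolP (w \in B).
      rewrite mulr1; apply: (@le_trans _ _ m%:R); last by rewrite lerDl.
      rewrite /act_count -[m in leRHS]card_ord -sumr_const; apply: ler_sum => r _.
      by case: ifP; rewrite ?ler01.
    move: wB; rewrite notin_setE /B /= => /negP; rewrite -ltNge => /ltW h.
    by rewrite mulr0 add0r.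
have mI : measurable_fun setT (fun w => (\1_B w : R)%:E).
  by apply/measurable_EFinP; exact: measurable_indic.
have I0 w : (0 <= (\1_B w : R)%:E)%E by rewrite lee_fin indicE.
have m0E : (0 <= (m%:R : R)%:E)%E by rewrite lee_fin.
have q0E : (0 <= (neg_prob_lb / 2 * m%:R)%:E)%E.
  by rewrite lee_fin; apply: mulr_ge0 => //; have := neg_prob_lb_gt0; lra.
have mI0 w : (0 <= (m%:R : R)%:E * (\1_B w : R)%:E)%E by rewrite mule_ge0.
have int1 : (\int[P]_(w in [set: T]) (neg_prob_lb / 2 * m%:R)%:E =
    (neg_prob_lb / 2 * m%:R)%:E :> \bar R)%E.
  rewrite integral_cst//; have PT := probability_setT P.
  by rewrite [X in (_ * X)%E]PT mule1.
move: (le_trans h1 h2).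
rewrite (ge0_integralD P measurableT (fun w _ => mI0 w) (measurable_funeM _ mI)
  (fun w _ => q0E) (measurable_cst _)).
rewrite (ge0_integralZl P measurableT mI (fun w _ => I0 w) m0E).
rewrite integral_indicP// pE int1 -EFinM -EFinD lee_fin => h.
rewrite lee_fin.
have : neg_prob_lb / 2 * m%:R <= p * m%:R by lra.
by rewrite ler_pM2r.
Qed.

End initialization.

(** * Convergence *)

(** Union bound over the data points of three bad events: output above [tau], output below [- tau],
    too many neurons near the boundary. The Chernoff parameter for the outputs is [tau] itself, the
    optimal choice. *)
Lemma good_event dT (T : measurableType dT) (R : realType) (P : probability T R)
    (m d n : nat) (U : 'I_m -> 'I_d -> {RV P >-> R}) (A : 'I_m -> {RV P >-> R})
    (x : 'I_n -> 'I_d -> R) (tau D b : R) :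
  mutually_independent P (init_family U A) ->
  (forall r k B, measurable B -> P (U r k @^-1` B) = normal_prob 0 1 B) ->
  (forall r, P (A r @^-1` [set 1]) = (1/2)%:E /\ P (A r @^-1` [set -1]) = (1/2)%:E) ->
  (0 < m)%N -> (forall i, dotv (x i) (x i) = 1) -> 0 < tau -> 0 < D ->
  exists E : set T, [/\ measurable E,
    ((1 - n%:R * (2 * expR (- (tau ^+ 2 / 2)) + expR (2 * D * m%:R - b / 2)))%:E <= P E)%E &
    forall w, E w -> [/\ forall r, `|A r w| = 1,
      forall i, `|net (fun r => A r w) (fun r k => U r k w) (x i)| <= tau &
      forall i, \sum_r (if `|dotv (fun k => U r k w) (x i)| <= D then 1 else 0) <= b]].
Proof.
move=> ind lU lA m0 x1 tau0 D0.
pose B1 i := signs A `&` [set w | tau ^+ 2 <= tau * netw U A (x i) w].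
pose B2 i := signs A `&` [set w | tau ^+ 2 <= - tau * netw U A (x i) w].
pose B3 i := [set w | b <= flip_count U (x i) D w].
have mS := measurable_signs U A.
have mB1 i : measurable (B1 i).
  apply: measurableI => //; apply: measurable_ge; apply: measurable_funM => //.
  exact: measurable_netw.
have mB2 i : measurable (B2 i).
  apply: measurableI => //; apply: measurable_ge; apply: measurable_funM => //.
  exact: measurable_netw.
have mB3 i : measurable (B3 i).
  by apply: measurable_ge; exact: measurable_flip_count.
pose F i := B1 i `|` B2 i `|` B3 i.
have mF i : measurable (F i) by apply: measurableU => //; exact: measurableU.
pose c := 2 * expR (- (tau ^+ 2 / 2)) + expR (2 * D * m%:R - b / 2).
have Fc i : (P (F i) <= c%:E)%E.
  have h1 : (P (B1 i) <= (expR (- (tau ^+ 2 / 2)))%:E)%E.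
    apply: (le_trans (net_tail ind lU lA _ _ m0 (x1 i))); rewrite lee_fin ler_expR; lra.
  have h2 : (P (B2 i) <= (expR (- (tau ^+ 2 / 2)))%:E)%E.
    apply: (le_trans (net_tail ind lU lA _ _ m0 (x1 i))); rewrite sqrrN lee_fin ler_expR; lra.
  have h3 := flip_tail ind lU b (x1 i) D0.
  apply: (le_trans (measureU2 P (measurableU _ _ (mB1 i) (mB2 i)) (mB3 i))).
  apply: (le_trans (leeD (measureU2 P (mB1 i) (mB2 i)) h3)).
  apply: (le_trans (leeD (leeD h1 h2) (lexx _))).
  by rewrite -!EFinD lee_fin /c; lra.
have [mU PU] := union_bound mF Fc.
pose B := [set w | exists i, F i w] `|` ~` signs A.
have mB : measurable B by apply: measurableU => //; exact: measurableC.
have PB : (P B <= (n%:R * c)%:E)%E.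
  apply: (le_trans (measureU2 P mU (measurableC mS))).
  apply: (le_trans (leeD PU (signs_prob U lA))).
  by rewrite adde0 sumr_const card_ord mulr_natl.
exists (~` B); split; first exact: measurableC.
  have [p pE] : exists p : R, P B = p%:E.
    by exists (fine (P B)); rewrite fineK// fin_num_measure.
  by rewrite probability_setC// pE -EFinB lee_fin; move: PB; rewrite pE lee_fin -/c; lra.
move=> w /not_orP[nF /contrapT sw]; split.
- by move=> r; case: (sw r) => ->; rewrite ?normrN normr1.
- move=> i; rewrite leNgt; apply/negP => h; apply: nF; exists i; left.
  rewrite -/(netw U A (x i) w) in h *; move: h; rewrite lter_normr => /orP[] h; [left|right].
    by split=> //=; rewrite expr2 ler_pM2l// ltW.
  by split=> //=; rewrite expr2 mulNr -mulrN ler_pM2l// ltW.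
- move=> i; rewrite leNgt; apply/negP => h; apply: nF; exists i; right.
  exact: ltW.
Qed.

Lemma gram0_sym (R : realType) (n d m : nat) (x : 'I_n -> 'I_d -> R) (u : 'I_m -> 'I_d -> R) :
  (gram0 x u)^T = gram0 x u.
Proof.
apply/matrixP => i j; rewrite !mxE; congr (_ * _); apply: eq_bigr => r _.
by rewrite andbC; congr (_ * _); apply: eq_bigr => k _; rewrite mulrC.
Qed.

(** Since the condition number is at least 1, it may be dropped from the step-size bound. The
    initial residual norm is at most [sqrt n * (Cy + tau)], which turns the condition on [D] into an
    explicit one. *)
Lemma fed_convergence_init (R : realType) (Cy : R) (n d m N K : nat)
    (x : 'I_n -> 'I_d -> R) (y : 'I_n -> R) (S : 'I_N -> {set 'I_n}) (el eg : R)
    (a : 'I_m -> R) (u0 : 'I_m -> 'I_d -> R) (tau D nu : R) :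
  let lam := lambda_min (gram0 x u0) in
  (0 < n)%N -> (0 < m)%N -> (0 < N)%N -> (0 < K)%N ->
  (forall i, dotv (x i) (x i) = 1) -> (forall i, `|y i| <= Cy) ->
  (forall (c c' : 'I_N) (i : 'I_n), i \in S c -> i \in S c' -> c = c') ->
  (forall i : 'I_n, exists c : 'I_N, i \in S c) ->
  0 < el -> 0 < eg -> eg <= 1 -> 0 < lam <= 1 ->
  el <= 1 / 20 * lam / (cond_number (gram0 x u0) * K%:R * n%:R ^+ 2) ->
  (forall r, `|a r| = 1) -> (forall i, `|net a u0 (x i)| <= tau) ->
  (forall i, \sum_r (if `|dotv (u0 r) (x i)| <= D then 1 else 0) <= nu * m%:R) ->
  0 <= nu -> nu * n%:R <= lam / 20 ->
  8 * n%:R * (Cy + tau) / (lam * Num.sqrt m%:R) <= D ->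
  forall t, sq_err a x y (fed_iter K a x y S el eg u0 t) <=
    (1 - eg * el * lam * K%:R / (2 * N%:R)) ^+ t * sq_err a x y u0.
Proof.
move=> lam n0 m0 N0 K0 x1 yC Sd Sc el0 eg0 eg1 lam01 elk a1 nett fl nu0 nun hD.
have [lamp lam1] := andP lam01.
have sm0 : 0 < Num.sqrt m%:R :> R by rewrite sqrtr_gt0 ltr0n.
have n1 : 1 <= n%:R :> R by rewrite ler1n.
have k1 : 1 <= cond_number (gram0 x u0) by apply: cond_number_ge1 => //; exact: gram0_sym.
have KR : 0 < K%:R :> R by rewrite ltr0n.
have nR : 0 < n%:R :> R by rewrite ltr0n.
have el2 : el * K%:R * n%:R ^+ 2 <= lam / 20.
  have k0 : 0 < cond_number (gram0 x u0) by exact: lt_le_trans k1.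
  move: elk; rewrite ler_pdivlMr; last first.
    by apply: mulr_gt0; [exact: mulr_gt0|exact: exprn_gt0].
  have : el * K%:R * n%:R ^+ 2 * 1 <= el * K%:R * n%:R ^+ 2 * cond_number (gram0 x u0).
    apply: ler_wpM2l => //; apply: mulr_ge0; last by rewrite exprn_ge0 ?ltW.
    by rewrite mulr_ge0 ?ltW.
  lra.
have el3 : 2 * n%:R * K%:R * el <= 1.
  have : el * K%:R * n%:R <= el * K%:R * n%:R ^+ 2.
    by apply: ler_wpM2l; [rewrite mulr_ge0 ?ltW|rewrite expr2 ler_peMr// ltW].
  lra.
apply: (@fed_convergence R n d m x y a m0 x1 a1 N K S el eg N0 Sd Sc (ltW el0) (ltW eg0)
  el3 u0 D nu lam) => //.
- move=> v; have [_ /(_ (\row_j v j))] := lambda_min_quad n0 (gram0_sym x u0).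
  have -> : ((\row_j v j) *m (\row_j v j)^T) 0 0 = \sum_i v i ^+ 2.
    by rewrite mxE; apply: eq_bigr => i _; rewrite !mxE expr2.
  have -> : ((\row_j v j) *m gram0 x u0 *m (\row_j v j)^T) 0 0 =
      \sum_i v i * \sum_j gram0 x u0 i j * v j.
    rewrite -mulmxA mxE; apply: eq_bigr => i _; rewrite mxE; congr (_ * _).
    by rewrite mxE; apply: eq_bigr => j _; congr (_ * _); rewrite !mxE.
  by [].
- apply: le_trans hD; rewrite ler_pM2r; last by rewrite invr_gt0 mulr_gt0.
  rewrite -!mulrA ler_pM2l//.
  have Ct : 0 <= Cy + tau.
    by have := normr_ge0 (y (Ordinal n0)); have := yC (Ordinal n0);
       have := normr_ge0 (net a u0 (x (Ordinal n0))); have := nett (Ordinal n0); lra.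
  rewrite -sqrtrM//; have -> : n%:R * (Cy + tau) = Num.sqrt ((n%:R * (Cy + tau)) ^+ 2).
    by rewrite sqrtr_sqr ger0_norm// mulr_ge0// ltW.
  rewrite ler_sqrt; last exact: sqr_ge0.
  have -> : (n%:R * (Cy + tau)) ^+ 2 = n%:R * (n%:R * (Cy + tau) ^+ 2) by ring.
  rewrite ler_pM2l// /sq_err.
  apply: (@le_trans _ _ (\sum_(i < n) (Cy + tau) ^+ 2)); last first.
    by rewrite sumr_const card_ord mulr_natl.
  apply: ler_sum => i _; rewrite -real_normK ?num_real// ler_pXn2r ?nnegrE//.
  apply: (le_trans (ler_normB _ _)); rewrite addrC; exact: lerD.
Qed.

(* [lams] is a deterministic lower bound for [lambda_min]; the window [D] of neurons that may
   flip and the admissible fraction [nu] of flips are both calibrated on it. *)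
Lemma fed_convergence_whp (R : realType) : exists2 k : R, 0 < k &
  forall (Cy lams Lam : R) (n d m : nat)
    (x : 'I_n -> 'I_d -> R) dT (T : measurableType dT) (P : probability T R)
    (U : 'I_m -> 'I_d -> {RV P >-> R}) (A : 'I_m -> {RV P >-> R}),
  mutually_independent P (init_family U A) ->
  (forall r k B, measurable B -> P (U r k @^-1` B) = normal_prob 0 1 B) ->
  (forall r, P (A r @^-1` [set 1]) = (1/2)%:E /\ P (A r @^-1` [set -1]) = (1/2)%:E) ->
  (0 < n)%N -> (0 < m)%N -> (forall i, dotv (x i) (x i) = 1) ->
  0 < Cy -> 0 < lams -> 0 < Lam ->
  k * n%:R ^+ 2 * (Cy + Num.sqrt (2 * Lam)) <= lams ^+ 2 * Num.sqrt m%:R ->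
  k * n%:R * Lam <= lams * m%:R ->
  exists E : set T, [/\ measurable E,
    ((1 - 3 * n%:R * expR (- Lam))%:E <= P E)%E &
    forall w, E w -> forall (N K : nat) (y : 'I_n -> R) (S : 'I_N -> {set 'I_n}) (el eg : R),
      let u0 := fun r k => U r k w in
      let a := fun r => A r w in
      let lam := lambda_min (gram0 x u0) in
      (0 < N)%N -> (0 < K)%N -> (forall i, `|y i| <= Cy) ->
      (forall (c c' : 'I_N) (i : 'I_n), i \in S c -> i \in S c' -> c = c') ->
      (forall i : 'I_n, exists c : 'I_N, i \in S c) ->
      0 < el -> 0 < eg -> eg <= 1 -> 0 < lam <= 1 -> lams <= lam ->
      el <= 1 / 20 * lam / (cond_number (gram0 x u0) * K%:R * n%:R ^+ 2) ->
      forall t, sq_err a x y (fed_iter K a x y S el eg u0 t) <=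
        (1 - eg * el * lam * K%:R / (2 * N%:R)) ^+ t * sq_err a x y u0].
Proof.
(* [1280 = 8 * 8 * 20] yields [8 * D <= nu], so the mean number of near-boundary neurons is well
   below the allowed [nu * m]. *)
exists 1280; first by rewrite ltr0n.
move=> Cy lams Lam n d m x dT T P U A ind lU lA n0 m0 x1 Cy0 lams0 Lam0 h1 h2.
pose tau := Num.sqrt (2 * Lam); pose sm : R := Num.sqrt m%:R.
have sm0 : 0 < sm by rewrite sqrtr_gt0 ltr0n.
have smm : sm ^+ 2 = m%:R by rewrite sqr_sqrtr.
have tau0 : 0 < tau by rewrite sqrtr_gt0 mulr_gt0.
have tau2 : tau ^+ 2 = 2 * Lam by rewrite sqr_sqrtr// ltW// mulr_gt0.
have nR : 0 < n%:R :> R by rewrite ltr0n.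
pose D := 8 * n%:R * (Cy + tau) / (lams * sm).
pose nu := lams / (20 * n%:R).
have D0 : 0 < D by rewrite divr_gt0 ?mulr_gt0// addr_gt0.
have nu0 : 0 <= nu by rewrite divr_ge0 ?mulr_ge0 ?ltW.
have [E [mE PE EE]] := good_event (nu * m%:R) ind lU lA m0 x1 tau0 D0.
exists E; split => //.
  (* The choice of [tau] makes each output tail [expR (- Lam)]. In the flip tail,
     [2 * D * m <= nu * m / 4] and [4 * Lam <= nu * m] give the same bound, hence the factor 3. *)
  apply: le_trans PE; rewrite lee_fin lerD2l lerN2.
  have e1 : expR (- (tau ^+ 2 / 2)) = expR (- Lam).
    by rewrite tau2; congr expR; field.
  have e2 : expR (2 * D * m%:R - nu * m%:R / 2) <= expR (- Lam).
    rewrite ler_expR.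
    have d1 : 8 * D <= nu.
      rewrite /D /nu ler_pdivlMr ?mulr_gt0//.
      have -> : 8 * (8 * n%:R * (Cy + tau) / (lams * sm)) * (20 * n%:R) =
        1280 * n%:R ^+ 2 * (Cy + tau) / (lams * sm) by ring.
      rewrite ler_pdivrMr ?mulr_gt0//; have -> : lams * (lams * sm) = lams ^+ 2 * sm by ring.
      exact: h1.
    have d2 : 2 * D * m%:R <= nu / 4 * m%:R by apply: ler_wpM2r => //; lra.
    have d3 : 4 * Lam <= nu * m%:R.
      rewrite /nu mulrAC ler_pdivlMr ?mulr_gt0//; apply: le_trans h2.
      have -> : 4 * Lam * (20 * n%:R) = 80 * n%:R * Lam by ring.
      by rewrite ler_pM2r// ler_pM2r// ler_nat.
    lra.
  rewrite e1; have -> : 3 * n%:R * expR (- Lam) = n%:R * (2 * expR (- Lam) + expR (- Lam)) by ring.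
  by rewrite ler_pM2l// lerD2l.
move=> w Ew N K y S el eg u0 a lam N0 K0 yC Sd Sc el0 eg0 eg1 lam01 laml elk.
have [a1 nt fl] := EE w Ew; have [lam0 lam1] := andP lam01.
apply: (@fed_convergence_init R Cy n d m N K x y S el eg a u0 tau D nu) => //.
- by rewrite /nu mulrAC ler_pdivrMr ?mulr_gt0//; nra.
- rewrite /D ler_pM2l; last by rewrite !mulr_gt0// addr_gt0.
  by rewrite lef_pV2 ?posrE ?mulr_gt0// ler_pM2r.
Qed.

(** * The case of one data point and the calibration of the constants *)

Lemma gram0_1E (R : realType) (d m : nat) (x : 'I_1 -> 'I_d -> R) (u : 'I_m -> 'I_d -> R) :
  dotv (x ord0) (x ord0) = 1 ->
  lambda_min (gram0 x u) =
    m%:R^-1 * \sum_r (if 0 <= dotv (u r) (x ord0) then 1 else 0).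
Proof.
move=> x1; have [/eigenvalueP[v vH v0] _] := lambda_min_quad (ltn0Sn 0) (gram0_sym x u).
have v00 : v 0 0 != 0.
  by apply: contra v0 => /eqP h; apply/eqP/rowP => j; rewrite !ord1 h mxE.
have : v 0 0 * gram0 x u 0 0 = lambda_min (gram0 x u) * v 0 0.
  have /matrixP/(_ 0 0) := vH; rewrite [in LHS]mxE big_ord1 => ->.
  by rewrite mxE.
rewrite mulrC => /(mulIf v00) <-; rewrite mxE; congr (_ * _).
by apply: eq_bigr => r _; rewrite x1 mul1r andbb.
Qed.

Lemma fourth_root_bound (R : realType) (c lam m : R) : 0 < lam -> 0 < m -> 0 <= c ->
  c / m <= lam ^+ 4 -> Num.sqrt (Num.sqrt (c / m)) <= lam.
Proof.
move=> l0 m0 c0 h.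
have e : lam = Num.sqrt (Num.sqrt (lam ^+ 4)).
  have -> : lam ^+ 4 = (lam ^+ 2) ^+ 2 by ring.
  by rewrite sqrtr_sqr (ger0_norm (sqr_ge0 _)) sqrtr_sqr gtr0_norm.
by rewrite e; apply: ler_wsqrtr; exact: ler_wsqrtr.
Qed.

(** The product [lams ^+ 2 * sqrt m] is free of [m], which settles the first inequality after
    squaring; the second uses [lams ^+ 4 <= lams]. The lower bound [L0] on [L] lets multiples of [L]
    absorb both [Cy ^+ 2] and [l3]. *)
Lemma calibration (R : realType) (k Cy l3 L0 L Cm n m : R) :
  let C1 := 1 + l3 / L0 in let lams := Num.sqrt (Num.sqrt (Cm * n ^+ 4 * L / m)) in
  0 < k -> 0 < Cy -> 0 < l3 -> 0 < L0 -> L0 <= L -> 1 <= n -> 0 < m ->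
  k ^+ 2 * (2 * Cy ^+ 2 / L0 + 4 * C1) + k * C1 <= Cm -> lams <= 1 ->
  k * n ^+ 2 * (Cy + Num.sqrt (2 * (l3 + L))) <= lams ^+ 2 * Num.sqrt m /\
  k * n * (l3 + L) <= lams * m.
Proof.
move=> C1 lams k0 Cy0 l30 L00 L0L n1 m0 hCm lams1.
have L_gt0 : 0 < L by exact: lt_le_trans L0L.
have n0 : 0 < n by exact: lt_le_trans n1.
have C10 : 0 < C1 by rewrite addr_gt0// divr_gt0.
have kC1 : 0 < k * C1 by exact: mulr_gt0.
have CA0 : 0 <= k ^+ 2 * (2 * Cy ^+ 2 / L0 + 4 * C1).
  apply: mulr_ge0; first exact: sqr_ge0.
  by apply: addr_ge0; [rewrite divr_ge0 ?(ltW L00)// mulr_ge0// sqr_ge0|rewrite mulr_ge0// ltW].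
have CAL : k ^+ 2 * (2 * Cy ^+ 2 / L0 + 4 * C1) * L <= Cm * L.
  rewrite ler_pM2r//; apply: le_trans hCm; rewrite lerDl; exact: ltW.
have CBL : k * C1 * L <= Cm * L by rewrite ler_pM2r//; apply: le_trans hCm; rewrite lerDr.
have Cm0 : 0 < Cm by apply: lt_le_trans hCm; exact: ltr_wpDl.
have cpos : 0 < Cm * n ^+ 4 * L / m.
  by rewrite divr_gt0// mulr_gt0// mulr_gt0// exprn_gt0.
have lams0 : 0 < lams by rewrite !sqrtr_gt0.
have lams2 : lams ^+ 2 = Num.sqrt (Cm * n ^+ 4 * L / m) by rewrite sqr_sqrtr// sqrtr_ge0.
have lams4 : lams ^+ 4 = Cm * n ^+ 4 * L / m.
  have -> : lams ^+ 4 = (lams ^+ 2) ^+ 2 by ring.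
  by rewrite lams2 sqr_sqrtr// ltW.
have Lam0 : 0 < l3 + L by exact: addr_gt0.
have LamC : l3 + L <= C1 * L.
  rewrite /C1 [leRHS]mulrDl mul1r [leRHS]addrC lerD2r mulrAC ler_pdivlMr// ler_pM2l//.
split.
  rewrite lams2 -sqrtrM; last exact: ltW.
  rewrite divfK ?gt_eqF//.
  have X0 : 0 <= k * n ^+ 2 * (Cy + Num.sqrt (2 * (l3 + L))).
    apply: mulr_ge0; last by rewrite addr_ge0 ?sqrtr_ge0// ltW.
    by rewrite mulr_ge0 ?sqr_ge0// ltW.
  rewrite -[leLHS](ger0_norm X0) -sqrtr_sqr; apply: ler_wsqrtr.
  have -> : (k * n ^+ 2 * (Cy + Num.sqrt (2 * (l3 + L)))) ^+ 2 =
    n ^+ 4 * (k ^+ 2 * (Cy + Num.sqrt (2 * (l3 + L))) ^+ 2) by ring.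
  have -> : Cm * n ^+ 4 * L = n ^+ 4 * (Cm * L) by ring.
  apply: ler_wpM2l; first by rewrite exprn_ge0// ltW.
  apply: le_trans CAL; rewrite -mulrA; apply: ler_wpM2l; first exact: sqr_ge0.
  rewrite [leRHS]mulrDl; set s := Num.sqrt (2 * (l3 + L)).
  have s2 : s ^+ 2 = 2 * (l3 + L) by apply: sqr_sqrtr; lra.
  have e1 : (Cy + s) ^+ 2 <= 2 * Cy ^+ 2 + 2 * s ^+ 2.
    have -> : 2 * Cy ^+ 2 + 2 * s ^+ 2 = (Cy + s) ^+ 2 + (Cy - s) ^+ 2 by ring.
    by rewrite lerDl sqr_ge0.
  apply: (le_trans e1); apply: lerD.
    rewrite mulrAC ler_pdivlMr//; apply: ler_wpM2l => //.
    by rewrite mulr_ge0// sqr_ge0.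
  have -> : 2 * s ^+ 2 = 4 * (l3 + L) by rewrite s2; ring.
  by rewrite -mulrA; apply: ler_wpM2l.
have b1 : lams ^+ 4 <= lams.
  rewrite exprS ler_piMr ?(ltW lams0)//; apply: exprn_ile1 => //; exact: ltW.
have b2 : lams ^+ 4 * m = Cm * n ^+ 4 * L by rewrite lams4 divfK// gt_eqF.
apply: (@le_trans _ _ (lams ^+ 4 * m)); last by rewrite ler_pM2r.
have b4 : n <= n ^+ 4 by rewrite exprS ler_peMr ?exprn_ege1// ltW.
rewrite b2; apply: (@le_trans _ _ (n * (k * C1 * L))).
  have -> : k * n * (l3 + L) = n * (k * (l3 + L)) by ring.
  by rewrite ler_pM2l// -mulrA ler_pM2l.
have -> : Cm * n ^+ 4 * L = n ^+ 4 * (Cm * L) by ring.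
by apply: ler_pM => //; [exact: ltW|rewrite mulr_ge0// ltW].
Qed.

Theorem theoremB3 (R : realType) (Cy : R) : 0 < Cy ->
  exists (Cm c_loc c_glob : R), 0 < Cm /\ 0 < c_loc /\ 0 < c_glob /\
  forall (n d m N K : nat) (x : 'I_n -> 'I_d -> R) (y : 'I_n -> R)
    (S : 'I_N -> {set 'I_n}) (delta eta_local eta_global : R)
    (dT : measure_display) (T : measurableType dT) (P : probability T R)
    (U : 'I_m -> 'I_d -> {RV P >-> R}) (A : 'I_m -> {RV P >-> R}),
  (0 < n)%N -> (0 < d)%N -> (0 < m)%N -> (0 < N)%N -> (0 < K)%N ->
  (forall i, dotv (x i) (x i) = 1) ->
  (forall i, `|y i| <= Cy) ->
  (forall (c c' : 'I_N) (i : 'I_n), i \in S c -> i \in S c' -> c = c') ->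
  (forall i : 'I_n, exists c : 'I_N, i \in S c) ->
  (forall c, (0 < #|S c|)%N) ->
  0 < delta < 1 ->
  0 < eta_local -> 0 < eta_global -> eta_global <= c_glob ->
  mutually_independent P (init_family U A) ->
  (forall r k B, measurable B -> P (U r k @^-1` B) = normal_prob 0 1 B) ->
  (forall r, P (A r @^-1` [set 1]) = (1/2)%:E /\
             P (A r @^-1` [set -1]) = (1/2)%:E) ->
  exists E : set T, measurable E /\ ((1 - delta)%:E <= P E)%E /\
    forall w, E w ->
      let u0 := fun r k => U r k w in
      let a := fun r => A r w in
      let H0 := gram0 x u0 in
      let lam := lambda_min H0 in
      let kappa := cond_number H0 in
      0 < lam <= 1 ->
      Cm * lam ^- 4 * n%:R ^+ 4 * ln (n%:R / delta) <= m%:R ->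
      eta_local <= c_loc * lam / (kappa * K%:R * n%:R ^+ 2) ->
      forall t : nat,
        sq_err a x y (fed_iter K a x y S eta_local eta_global u0 t) <=
        (1 - eta_global * eta_local * lam * K%:R / (2 * N%:R)) ^+ t *
        sq_err a x y u0.
Proof.
move=> Cy0.
have qp := neg_prob_lb_gt0 R; set q := neg_prob_lb R in qp.
have q1 : q <= 1.
  have h1 : expR (1 / 2 : R) - 1 <= 1 by have := expR_half_le2 R; lra.
  have h2 : 0 <= expR (1 / 2 : R) - 1 by have := expR_ge1Dx (1 / 2 : R); lra.
  rewrite /q /neg_prob_lb ler_pdivrMr ?expR_gt0// [leRHS]mul1r.
  apply: (@le_trans _ _ 1); first exact: (exprn_ile1 2 h2 h1).
  by rewrite -[leLHS]expR0 ler_expR.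
(* Beyond [delta0] the required success probability is below [q / 4]. *)
pose delta0 := 1 - q / 4.
have d0p : 0 < delta0 by rewrite /delta0; lra.
have d01 : delta0 < 1 by rewrite /delta0; lra.
(* [ln (n / delta)] is at least [ln 2] for [n >= 2], and at least [- ln delta0] for [n = 1] and
   [delta <= delta0]. A value below [L0] therefore forces [n = 1] and [delta > delta0]. *)
pose L0 := Num.min (ln (2 : R)) (- ln delta0).
have L00 : 0 < L0.
  rewrite lt_min ln_gt0 ?ltr1n//= oppr_gt0; by apply: ln_lt0; rewrite d0p d01.
pose C1 := 1 + ln (3 : R) / L0.
have ln3 : 0 < ln (3 : R) by rewrite ln_gt0 ?ltr1n.
have C10 : 0 < C1 by rewrite addr_gt0// divr_gt0.
(* Chosen so that the failure probability [3 * expR (- Lb)] for one data point is [q / 4]. *)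
pose Lb := ln (12 / q).
have Lb0 : 0 < Lb by rewrite ln_gt0// ltr_pdivlMr//; lra.
have [k k0 whp] := fed_convergence_whp R.
have [g gE] : exists g : R, g = k * (Cy + Num.sqrt (2 * Lb)) by eexists.
have g0 : 0 < g by rewrite gE mulr_gt0// ltr_pwDl// sqrtr_ge0.
(* From this width on, both width conditions of [whp] hold for [n = 1] with threshold [q / 2] and
   [Lam = Lb]. *)
pose M0r := (g / (q / 2) ^+ 2) ^+ 2 + k * Lb / (q / 2) + 1.
have q2 : 0 < q / 2 by lra.
have gq0 : 0 < g / (q / 2) ^+ 2 by rewrite divr_gt0// exprn_gt0.
have M0p : 0 < M0r.
  have h1 : 0 <= (g / (q / 2) ^+ 2) ^+ 2 by exact: sqr_ge0.
  have h2 : 0 < k * Lb / (q / 2) by rewrite divr_gt0// mulr_gt0.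
  rewrite /M0r; lra.
have [M0 M0E] : exists M0 : nat, M0r < M0%:R.
  by exists (Num.trunc M0r).+1; exact: truncnS_gt.
have [Cma CmaE] : exists c : R, c = k ^+ 2 * (2 * Cy ^+ 2 / L0 + 4 * C1) by eexists.
(* For widths below [M0], this share of [Cm] makes [Cm * L <= m] imply [L <= q ^+ M0]. *)
pose Cmb := M0%:R / q ^+ M0.
have Cma0 : 0 <= Cma.
  rewrite CmaE mulr_ge0 ?exprn_ge0 ?(ltW k0)// addr_ge0//; last by rewrite mulr_ge0// ltW.
  by rewrite divr_ge0 ?(ltW L00)// mulr_ge0// sqr_ge0.
have Cmb0 : 0 <= Cmb by rewrite divr_ge0// exprn_ge0// ltW.
have kC1 : 0 < k * C1 by exact: mulr_gt0.
pose Cm := Cma + k * C1 + Cmb.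
have Cm0 : 0 < Cm by rewrite /Cm; lra.
exists Cm, (1 / 20), 1; split=> //; split; first by lra.
split=> //.
move=> n d m N K x y S delta el eg dT T P U A n0 d0 m0 N0 K0 x1 yC Sd Sc _ /andP[de0 de1]
  el0 eg0 eg1 ind lU lA.
have mR : 0 < m%:R :> R by rewrite ltr0n.
have nR : 1 <= n%:R :> R by rewrite ler1n.
(* If no sample satisfies the assumptions on [lam] and [m], the whole space serves as the event. *)
have vacuous : (forall w, let lam := lambda_min (gram0 x (fun r k => U r k w)) in
    0 < lam <= 1 -> Cm * lam ^- 4 * n%:R ^+ 4 * ln (n%:R / delta) <= m%:R -> False) ->
    exists E : set T, measurable E /\ ((1 - delta)%:E <= P E)%E /\
    forall w, E w ->
      let u0 := fun r k => U r k w in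
      let a := fun r => A r w in
      let H0 := gram0 x u0 in
      let lam := lambda_min H0 in
      let kappa := cond_number H0 in
      0 < lam <= 1 ->
      Cm * lam ^- 4 * n%:R ^+ 4 * ln (n%:R / delta) <= m%:R ->
      el <= 1 / 20 * lam / (kappa * K%:R * n%:R ^+ 2) ->
      forall t : nat,
        sq_err a x y (fed_iter K a x y S el eg u0 t) <=
        (1 - eg * el * lam * K%:R / (2 * N%:R)) ^+ t *
        sq_err a x y u0.
  move=> h; exists setT; split; first exact: measurableT.
  split.
    have -> : P [set: T] = 1%E by exact: probability_setT.
    by rewrite lee_fin; lra.
  by move=> w _ u0 a H0 lam kappa h1 h2; have := h w h1 h2.
pose L := ln (n%:R / delta).
have nd1 : 1 < n%:R / delta by rewrite ltr_pdivlMr// mul1r; lra.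
have L_gt0 : 0 < L by rewrite ln_gt0.
have lamE (lam : R) : 0 < lam -> Cm * lam ^- 4 * n%:R ^+ 4 * ln (n%:R / delta) <= m%:R ->
    Cm * n%:R ^+ 4 * L / m%:R <= lam ^+ 4.
  move=> l0 h; have l4 : 0 < lam ^+ 4 by exact: exprn_gt0.
  rewrite ler_pdivrMr//; move: h; rewrite -/L.
  have -> : Cm * lam ^- 4 * n%:R ^+ 4 * L = (Cm * n%:R ^+ 4 * L) / lam ^+ 4 by ring.
  by rewrite ler_pdivrMr// [m%:R * _]mulrC.
have c0 : 0 <= Cm * n%:R ^+ 4 * L.
  by rewrite mulr_ge0 ?(ltW L_gt0)// mulr_ge0 ?exprn_ge0// ltW.
(* The deterministic threshold: solving the width assumption for [lam] bounds it below by this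
   fourth root. *)
pose lams := Num.sqrt (Num.sqrt (Cm * n%:R ^+ 4 * L / m%:R)).
have [L0L|LL0] := leP L0 L.
  have [lams1|lams1] := leP lams 1; last first.
    apply: vacuous => w lam /andP[l0 l1] /(lamE _ l0) h.
    have := fourth_root_bound l0 mR c0 h; rewrite -/lams; lra.
  have cpos : 0 < Cm * n%:R ^+ 4 * L / m%:R.
    by rewrite divr_gt0// mulr_gt0// mulr_gt0// exprn_gt0//; lra.
  have lams0 : 0 < lams by rewrite !sqrtr_gt0.
  (* Makes [3 * n * expR (- Lam)] equal to [delta]. *)
  pose Lam := ln 3 + L.
  have Lam0 : 0 < Lam by exact: addr_gt0.
  have CmaC : k ^+ 2 * (2 * Cy ^+ 2 / L0 + 4 * C1) + k * C1 <= Cm.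
    by rewrite -CmaE /Cm lerDl.
  have [h1 h2] := calibration k0 Cy0 ln3 L00 L0L nR mR CmaC lams1.
  have [E [mE PE EE]] := whp _ _ _ _ _ _ _ _ _ _ _ _ ind lU lA n0 m0 x1 Cy0 lams0 Lam0 h1 h2.
  exists E; split=> //; split.
    apply: le_trans PE; rewrite lee_fin /Lam opprD expRD !expRN lnK ?posrE//.
    rewrite lnK ?posrE; last by rewrite divr_gt0//; lra.
    have -> : 3 * n%:R * (3^-1 * (n%:R / delta)^-1) = delta.
      by field; rewrite !gt_eqF//; lra.
    by [].
  move=> w Ew u0 a H0 lam kappa lam01 hm hel t; have [l0 l1] := andP lam01.
  apply: (EE w Ew) => //.
  by apply: fourth_root_bound => //; exact: lamE.
have n1 : n = 1%N.
  apply/eqP; rewrite eqn_leq n0 andbT leqNgt; apply/negP => n2; move: LL0.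
  apply/negP; rewrite -leNgt; apply: (@le_trans _ _ (ln 2)); first by rewrite ge_min lexx.
  rewrite ler_ln ?posrE ?divr_gt0//; last by lra.
  rewrite ler_pdivlMr//; have : 2 <= n%:R :> R by rewrite ler_nat.
  lra.
subst n.
have Ldelta : L = - ln delta by rewrite /L div1r lnV// posrE.
have ded : delta0 < delta.
  move: LL0; rewrite lt_min Ldelta => /andP[_]; rewrite ltrN2 ltr_ln ?posrE//.
have v1 := x1 ord0.
have [mM|Mm] := leqP M0 m.
  have mM' : M0r <= m%:R by apply: (le_trans (ltW M0E)); rewrite ler_nat.
  have t1 : 0 <= k * Lb / (q / 2) by rewrite divr_ge0 ?(ltW q2)// mulr_ge0// ltW.
  have t2 : 0 <= (g / (q / 2) ^+ 2) ^+ 2 by exact: sqr_ge0.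
  have h1 : k * 1%:R ^+ 2 * (Cy + Num.sqrt (2 * Lb)) <= (q / 2) ^+ 2 * Num.sqrt m%:R.
    rewrite expr1n mulr1 -gE mulrC -ler_pdivrMr ?exprn_gt0//.
    rewrite -[leLHS](ger0_norm (ltW gq0)) -sqrtr_sqr; apply: ler_wsqrtr.
    by move: mM'; rewrite /M0r; lra.
  have h2 : k * 1%:R * Lb <= q / 2 * m%:R.
    rewrite mulr1 mulrC [leRHS]mulrC -ler_pdivrMr//.
    by move: mM'; rewrite /M0r [Lb * k]mulrC; lra.
  have [E [mE PE EE]] := whp _ _ _ _ _ _ _ _ _ _ _ _ ind lU lA n0 m0 x1 Cy0 q2 Lb0 h1 h2.
  (* For one data point the least eigenvalue is the fraction of active neurons, so on [F] it reaches
     the threshold [q / 2] for which [E] was built. *)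
  have [mF PF] := act_count_many ind lU m0 v1.
  set F := [set w | _] in mF PF.
  exists (E `&` F); split; first exact: measurableI.
  split.
    have [p pE] : exists p : R, P E = p%:E.
      by exists (fine (P E)); rewrite fineK// fin_num_measure.
    have [f fE] : exists f : R, P F = f%:E.
      by exists (fine (P F)); rewrite fineK// fin_num_measure.
    have [pI pIE] : exists p : R, P (E `&` F) = p%:E.
      by exists (fine (P (E `&` F))); rewrite fineK// fin_num_measure//; exact: measurableI.
    have [pD pDE] : exists p : R, P (E `\` F) = p%:E.
      by exists (fine (P (E `\` F))); rewrite fineK// fin_num_measure//; exact: measurableD.
    (* [E] fails with probability at most [q / 4] and [F] holds with probability at least [q / 2],
       so their intersection has at least [q / 4], which exceeds [1 - delta]. *)
    have e1 : p = pD + pI.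
      have : P E = (P (E `\` F) + P (E `&` F))%E by exact: measureDI.
      by rewrite pE pDE pIE => -[].
    have e2 : pD <= 1 - f.
      have : (P (E `\` F) <= P (~` F))%E.
        apply: le_measure; rewrite ?inE; [exact: measurableD|exact: measurableC|].
        by move=> w [].
      by rewrite probability_setC// pDE fE -EFinB lee_fin.
    have e3 : 3 * 1%:R * expR (- Lb) = q / 4.
      by rewrite expRN lnK ?posrE ?divr_gt0//; field; rewrite gt_eqF.
    move: PE PF; rewrite e3 pE fE pIE !lee_fin -/q.
    move: ded; rewrite /delta0; lra.
  move=> w [Ew Fw] u0 a H0 lam kappa lam01 hm hel t.
  apply: (EE w Ew) => //.
  rewrite /= gram0_1E// ler_pdivlMl// mulrC; exact: Fw.
(* As [lam <= 1], the width assumption entails [Cm * L <= m]; otherwise there is nothing to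
   prove. *)
have [Lm|Lm] := leP (Cm * L) m%:R; last first.
  apply: vacuous => w lam /andP[l0 l1] /(lamE _ l0) h.
  have : lam ^+ 4 <= 1 by apply: exprn_ile1 => //; exact: ltW.
  move: h; rewrite expr1n mulr1 => h1 h2.
  have := le_trans h1 h2; rewrite ler_pdivrMr// mul1r; lra.
(* With every neuron inactive [lam = 0], so the assumption [0 < lam] fails on the whole event. *)
exists [set w | forall r, preact U (x ord0) r w < 0]; split.
  by apply: measurable_forall => r; apply: measurable_lt; exact: (measurable_preact U A).
split.
  apply: le_trans (all_neg ind lU v1); rewrite lee_fin -/q.
  (* The chain is [1 - delta <= - ln delta = L <= q ^+ M0 <= q ^+ m]. *)
  have b1 : 1 - delta <= L.
    rewrite Ldelta; have : ln delta <= delta - 1.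
      have := expR_ge1Dx (ln delta); rewrite lnK ?posrE//; lra.
    lra.
  have b2 : Cmb * L <= M0%:R.
    apply: (@le_trans _ _ (Cm * L)); first by rewrite ler_pM2r// /Cm; lra.
    by apply: (le_trans Lm); rewrite ler_nat ltnW.
  have qM : 0 < q ^+ M0 by exact: exprn_gt0.
  have MR : 0 < M0%:R :> R by apply: lt_trans M0E.
  have b3 : L <= q ^+ M0.
    move: b2; rewrite /Cmb mulrAC ler_pdivrMr// ler_pM2l//.
  apply: (le_trans b1); apply: (le_trans b3).
  by apply: ler_wiXn2l => //; [exact: ltW|exact: ltnW].
move=> w wneg u0 a H0 lam kappa /andP[l0 l1]; move: l0.
rewrite /lam /H0 gram0_1E// big1 ?mulr0 ?ltxx// => r _.
by rewrite leNgt (wneg r).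
Qed.
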